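(* Let $v\in C(\overline{\mathbb B})$ be a viscosity solution of $$t^{-2}\Delta_{\mathbb B}u+t^{-2}(n-2)(t\partial_t u)+h(u)=f(t,x)\quad\text{in }\mathbb B,$$ with $\sup_{\mathbb B}|v|<+\infty$. If $t^2f\in C(\overline{\mathbb B})\cap\mathbb L^1_n(\mathbb B)$, then $$\sup_{\mathbb B}|v|\le \sup_{\partial\mathbb B}|v| + C^*K_0d_0\,\|t^2f\|_{\mathbb L^1_n(\mathbb B)},$$ where $K_0,d_0,\sigma$ are the constants of condition $(G^d_{\mathbb B})$ and the constant $C^*$ depends only on $n,K_0,d_0,\sigma$.
   Context: Standing setting. $n\ge 3$; $X\subset\mathbb R^{n-1}$ is a bounded convex open set with smooth boundary; $\mathbb B=(0,1)\times X$ with points $(t,x)$; $\partial\mathbb B=(\{1\}\times X)\cup((0,1]\times\partial X)$ (the set $t=0$ is not part of the boundary), and $\overline{\mathbb B}=\mathbb B\cup\partial\mathbb B=(0,1]\times\overline X$ is the closure for the cone distance. The function $h:\mathbb R\to\mathbb R$ is continuous, non-increasing, $h(0)=0$; $f$ is continuous in $\mathbb B$. Operators. $\nabla_{\mathbb B}=(t\partial_t,\partial_{x_1},\dots,\partial_{x_{n-1}})$, $\nabla_{\mathbb B}^2$ is the matrix of second-order derivatives formed with these vector fields, and $\Delta_{\mathbb B}u=\mathrm{tr}(\nabla^2_{\mathbb B}u)=(t\partial_t)^2u+\sum_{i=1}^{n-1}\partial_{x_i}^2u$. Viscosity solution. $u\in USC(\mathbb B)$ (resp. $u\in LSC(\mathbb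 B)$) is a viscosity subsolution (resp. supersolution) of the equation if for every $\phi\in C^2(\mathbb B)$ and every local maximum (resp. minimum) point $(t_0,x_0)\in\mathbb B$ of $u-\phi$ one has $t_0^{-2}\Delta_{\mathbb B}\phi(t_0,x_0)+t_0^{-2}(n-2)(t\partial_t\phi)(t_0,x_0)+h(u(t_0,x_0))\ge f(t_0,x_0)$ (resp. $\le$). A viscosity solution is both. Norm. $\|g\|_{\mathbb L^1_n(\mathbb B)}=\left(\int_{\mathbb B}|g|^n\frac{dt}{t}dx\right)^{1/n}$, and $g\in\mathbb L^1_n(\mathbb B)$ means this is finite. Cone distance. $d_{\mathbb B}((t,x),(s,y))=|(t,x)-(s,y)|_{\mathbb B}=\sqrt{(\ln t-\ln s)^2+|x-y|^2}$ on $\mathbb R^n_+=(0,\infty)\times\mathbb R^{n-1}$; $B_{\mathbb B}((s,y),r)$ is the open ball of radius $r$ for this distance, written $B_{\mathbb B}(r)$ when the centre is not specified; $d_{\partial\mathbb B}(t,x)=\inf_{(s,y)\in\partial\mathbb B}d_{\mathbb B}((t,x),(s,y))$; $|\Omega|_{\mathbb B}=\int_\Omega\frac{dt}{t}dx$. Condition $(G^d_{\mathbb B})$, assumed with constants $K_0\ge1$, $0<\sigma<1$, $d_0>0$: for every $(t,x)\in\mathbb B$ one has $d_{\partial\mathbb B}(t,x)\le d_0$ and there is a cone ball $B_{\mathbb B}(\tilde R_{(t,x)})$ (of some centre) of radius $\tilde R_{(t,x)}\le K_0d_{\partial\mathbb B}(t,x)$ with $(t,x)\in B_{\mathbb B}(\tilde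 R_{(t,x)})$ and $|B_{\mathbb B}(\tilde R_{(t,x)})\setminus\mathbb B|_{\mathbb B}\ge\sigma|B_{\mathbb B}(\tilde R_{(t,x)})|_{\mathbb B}$. (It holds e.g. with $K_0=2$, $\sigma=1/2$, $d_0=\mathrm{diam}(X)$.) *)

(* Defs.v *)
From HB Require Import structures.
From mathcomp Require Import all_boot all_order all_algebra.
From mathcomp Require Import all_classical all_reals all_analysis.

Set Implicit Arguments.
Unset Strict Implicit.
Unset Printing Implicit Defensive.

Import Order.TTheory GRing.Theory Num.Theory.
Import numFieldNormedType.Exports.

Local Open Scope classical_set_scope.
Local Open Scope ring_scope.

(** Lebesgue measure on [m.-tuple R], by recursion on [m]: the image of
    [lebesgue_measure \x (Lebesgue measure on m.-tuple R)] under [cons]. *)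

Definition tcons (T : Type) (m : nat) (z : T * m.-tuple T) : m.+1.-tuple T :=
  [tuple of z.1 :: z.2].

Lemma measurable_tcons d (T : measurableType d) (m : nat) :
  measurable_fun setT (@tcons T m).
Proof. exact: measurable_cons. Qed.

Definition lebesgue_cons (R : realType) (m : nat)
    (mu : set (m.-tuple (measurableTypeR R)) -> \bar R) :
    set (m.+1.-tuple (measurableTypeR R)) -> \bar R :=
  pushforward (lebesgue_measure \x mu)%E (@tcons (measurableTypeR R) m).

Section lebesgue_cons.
Context (R : realType) (m : nat).
Variable mu : {sigma_finite_measure set (m.-tuple (measurableTypeR R)) -> \bar R}.

Let mtcons := @measurable_tcons _ (measurableTypeR R) m.

Let lebesgue_cons0 : lebesgue_cons mu set0 = 0%E.
Proof. by rewrite /lebesgue_cons /pushforward preimage_set0 measure0. Qed.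

Let lebesgue_cons_ge0 A : (0 <= lebesgue_cons mu A)%E.
Proof. exact: measure_ge0. Qed.

Let lebesgue_cons_additive : semi_sigma_additive (lebesgue_cons mu).
Proof.
move=> F mF tF mUF; rewrite /lebesgue_cons /pushforward preimage_bigcup.
apply: measure_semi_sigma_additive.
- by move=> n; rewrite -[X in measurable X]setTI; exact: mtcons.
- apply/trivIsetP => /= i j _ _ ij; rewrite -preimage_setI.
  by move/trivIsetP : tF => /(_ _ _ _ _ ij) ->//; rewrite preimage_set0.
- by rewrite -preimage_bigcup -[X in measurable X]setTI; exact: mtcons.
Qed.

HB.instance Definition _ := isMeasure.Build _ _ _ (lebesgue_cons mu)
  lebesgue_cons0 lebesgue_cons_ge0 lebesgue_cons_additive.

Let lebesgue_cons_sigma_finite : sigma_finite setT (lebesgue_cons mu).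
Proof.
have /sigma_finiteP[F [TF ndF Foo]] := sigma_finiteT
  (@lebesgue_measure R : {sigma_finite_measure set (measurableTypeR R) -> \bar R}).
have /sigma_finiteP[G [TG ndG Goo]] := sigma_finiteT mu.
pose g (x : m.+1.-tuple (measurableTypeR R)) := (thead x, [tuple of behead x]).
have mg : measurable_fun setT g.
  apply: measurable_fun_pair; first exact: measurable_tnth.
  exact: measurable_behead.
have gK z : g (tcons z) = z.
  by case: z => a b; rewrite /g theadE; congr (_, _); exact/val_inj.
exists (fun k => g @^-1` (F k `*` G k)).
  rewrite -preimage_bigcup (_ : \bigcup_k _ = setT) ?preimage_setT//.
  rewrite -subTset => -[a b] _.
  have [k _ Fa] : (\bigcup_k F k) a by rewrite -TF.
  have [l _ Gb] : (\bigcup_k G k) b by rewrite -TG.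
  exists (maxn k l) => //; split => /=.
    by move: a Fa; exact/subsetPset/ndF/leq_maxl.
  by move: b Gb; exact/subsetPset/ndG/leq_maxr.
move=> k; have [mF Fk] := Foo k; have [mG Gk] := Goo k; split.
  by rewrite -[X in measurable X]setTI; apply: mg => //; exact: measurableX.
rewrite /lebesgue_cons /pushforward -comp_preimage.
rewrite (_ : g \o _ = id) ?preimage_id; last by apply/funext => z; exact: gK.
by rewrite product_measure1E// lte_mul_pinfty// ge0_fin_numE.
Qed.

HB.instance Definition _ := Measure_isSigmaFinite.Build _ _ _
  (lebesgue_cons mu) lebesgue_cons_sigma_finite.

End lebesgue_cons.

Fixpoint lebesgue_tuple (R : realType) (m : nat) :
    {sigma_finite_measure set (m.-tuple (measurableTypeR R)) -> \bar R} :=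
  match m with
  | 0 => \d_[tuple]
  | m'.+1 => lebesgue_cons (lebesgue_tuple R m')
  end.

Lemma lebesgue_tuple_box (R : realType) (m : nat)
    (A : 'I_m -> set (measurableTypeR R)) :
  (forall i, measurable (A i)) ->
  lebesgue_tuple R m [set x | forall i, A i (tnth x i)] =
  (\prod_(i < m) lebesgue_measure (A i))%E.
Proof.
elim: m A => [A _|m IHm A mA].
  rewrite big_ord0 /= diracE mem_set//; by case.
rewrite big_ord_recl /= /lebesgue_cons /pushforward.
rewrite (_ : _ @^-1` _ =
    A ord0 `*` [set x | forall i, A (lift ord0 i) (tnth x i)]); last first.
  apply/seteqP; split => -[a b] /=.
    move=> Aab; split=> [|i]; first exact: (Aab ord0).
    by have := Aab (lift ord0 i); rewrite /tcons tnthS.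
  move=> [Aa Ab] i; have [j ->|->] := unliftP ord0 i; last by [].
  by rewrite /tcons tnthS.
rewrite product_measure1E//; first by
  rewrite (IHm (fun i => A (lift ord0 i))).
rewrite (_ : [set x | _] =
    \bigcap_(i in [set: 'I_m]) [set x | A (lift ord0 i) (tnth x i)]); last first.
  by apply/seteqP; split=> [x Ax i _|x Ax i]; exact: Ax.
apply: fin_bigcap_measurable => [|i _]; first exact: finite_finset.
rewrite -[X in measurable X]setTI.
exact: (@measurable_tnth _ (measurableTypeR R) m i).
Qed.

Section cone.
Context (R : realType) (m : nat).

Local Notation pt := (R * 'rV[R]_m)%type.

Implicit Types (X : set 'rV[R]_m) (D : set pt) (p q : pt).

Definition continuous_in (V : topologicalType) (D : set V) (u : V -> R) :=
  forall x, D x -> {for x, continuous u}.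

(** [C_k D u]: [u] is of class C^k on the open set [D] of a finite-dimensional
    space. All directions are used rather than a basis of them, which yields
    the same class. *)
Fixpoint C_k (V : normedModType R) (k : nat) (D : set V) (u : V -> R) : Prop :=
  continuous_in D u /\
  if k is k'.+1 then
    forall w, (forall x, D x -> derivable u x w) /\ C_k k' D ('D_w u)
  else True.

Definition boundary (V : topologicalType) (A : set V) : set V :=
  closure A `\` A°.

(** Smoothness of the boundary through local defining functions, which by the
    implicit function theorem is the local description of [X] as one side of a
    smooth graph. Since [rho x = 0] follows, it is not required. *)
Definition smooth_boundary X :=
  forall x, boundary X x -> exists (U : set 'rV[R]_m) (rho : 'rV[R]_m -> R),
    [/\ open U /\ U x,
        forall k, C_k k U rho,
        exists w, 'D_w rho x != 0 &
        forall y, U y -> (X y <-> rho y < 0)].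

Definition cylinder X : set pt := [set p | 0 < p.1 < 1 /\ X p.2].

(** The part of the topological boundary at [t = 0] is not included. *)
Definition cylinder_boundary X : set pt :=
  [set p | (p.1 = 1 /\ X p.2) \/ (0 < p.1 <= 1 /\ boundary X p.2)].

Definition cylinder_closure X : set pt := cylinder X `|` cylinder_boundary X.

(** The measure [dt/t dx]; only used on subsets of [t > 0]. *)

Definition pt_of (z : measurableTypeR R * m.-tuple (measurableTypeR R)) : pt :=
  (z.1, \row_i tnth z.2 i).

Definition cone_integral D (g : pt -> \bar R) : \bar R :=
  (\int[lebesgue_measure \x lebesgue_tuple R m]_(z in pt_of @^-1` D)
     (g (pt_of z) * ((pt_of z).1^-1)%:E))%E.

Definition cone_volume D : \bar R := cone_integral D (cst 1%E).

(** The norm of [L^1_k(D)]. *)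
Definition cone_Lnorm (k : nat) D (g : pt -> R) : \bar R :=
  (cone_integral D (fun p => (`|g p| ^+ k)%:E) `^ (k%:R^-1))%E.

Definition cone_dist p q : R :=
  Num.sqrt ((ln p.1 - ln q.1) ^+ 2 + \sum_i (p.2 0 i - q.2 0 i) ^+ 2).

Definition cone_ball p (r : R) : set pt :=
  [set q | 0 < q.1 /\ cone_dist q p < r].

Definition dist_boundary X p : R :=
  inf [set cone_dist p q | q in cylinder_boundary X].

Definition condition_G X (K0 sigma d0 : R) :=
  forall p, cylinder X p ->
    dist_boundary X p <= d0 /\
    exists (c : pt) (r : R),
      [/\ 0 < c.1,
          r <= K0 * dist_boundary X p,
          cone_ball c r p &
          (sigma%:E * cone_volume (cone_ball c r) <=
             cone_volume (cone_ball c r `\` cylinder X))%E].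

(** The vector fields [t d/dt] (index 0) and [d/dx_j] (index [lift ord0 j]). *)
Definition cone_field (i : 'I_m.+1) (u : pt -> R) : pt -> R :=
  fun p => if unlift ord0 i is Some j then 'D_((0, delta_mx 0 j) : pt) u p
           else p.1 * 'D_((1, 0) : pt) u p.

Definition cone_hessian (u : pt -> R) p : 'M[R]_m.+1 :=
  \matrix_(i, j) cone_field i (cone_field j u) p.

Definition cone_laplacian (u : pt -> R) p : R := \tr (cone_hessian u p).

Lemma cone_laplacianE (u : pt -> R) p :
  cone_laplacian u p =
  p.1 * 'D_((1, 0) : pt) (fun q => q.1 * 'D_((1, 0) : pt) u q) p +
  \sum_(j < m) 'D_((0, delta_mx 0 j) : pt) ('D_((0, delta_mx 0 j) : pt) u) p.
Proof.
have cone_field0 w : cone_field ord0 w = fun q => q.1 * 'D_((1, 0) : pt) w q.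
  by apply/funext => q; rewrite /cone_field unlift_none.
have cone_fieldS j w : cone_field (lift ord0 j) w = 'D_((0, delta_mx 0 j) : pt) w.
  by apply/funext => q; rewrite /cone_field liftK.
rewrite /cone_laplacian /mxtrace big_ord_recl !mxE !cone_field0; congr (_ + _).
by apply: eq_bigr => j _; rewrite !mxE !cone_fieldS.
Qed.

(** [t^-2 Delta u + t^-2 (n - 2) t d_t u] in dimension [n = m.+1] *)
Definition cone_operator (u : pt -> R) p : R :=
  p.1 ^- 2 * cone_laplacian u p +
  p.1 ^- 2 * (m.+1%:R - 2) * cone_field ord0 u p.

Definition usc_in D (u : pt -> R) :=
  forall p, D p -> forall a, u p < a -> \forall q \near p, D q -> u q < a.

Definition lsc_in D (u : pt -> R) :=
  forall p, D p -> forall a, a < u p -> \forall q \near p, D q -> a < u q.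

Definition local_max_in D (g : pt -> R) p :=
  D p /\ \forall q \near p, D q -> g q <= g p.

Definition local_min_in D (g : pt -> R) p :=
  D p /\ \forall q \near p, D q -> g p <= g q.

Definition viscosity_subsolution (h : R -> R) (f : pt -> R) D (u : pt -> R) :=
  usc_in D u /\
  forall phi, C_k 2 D phi -> forall p, local_max_in D (u \- phi) p ->
    f p <= cone_operator phi p + h (u p).

Definition viscosity_supersolution (h : R -> R) (f : pt -> R) D (u : pt -> R) :=
  lsc_in D u /\
  forall phi, C_k 2 D phi -> forall p, local_min_in D (u \- phi) p ->
    cone_operator phi p + h (u p) <= f p.

Definition viscosity_solution (h : R -> R) (f : pt -> R) D (u : pt -> R) :=
  viscosity_subsolution h f D u /\ viscosity_supersolution h f D u.

End cone.

(* Main.v *)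
Require Import Defs.
From mathcomp Require Import all_boot all_order all_algebra.
From mathcomp Require Import all_classical all_reals all_analysis.
From mathcomp Require Import measurable_realfun ring lra zify.

(** In the coordinates [y_0 = ln t], [y_(j+1) = x_j] the operator, multiplied by
    [t^2], is [L = Delta + (n - 2) d/dy_0], with constant coefficients. Hence
    [e^(-(n-2) y_0 / 2) |y|^(2-n)] is a supersolution, and a finite grid sum of
    regularised translates of it, weighted by the values of [|t^2 f|], is a smooth
    [phi >= 0] with [L phi <= - |t^2 f|] on a given compact part of a cone ball.
    As [n > n / 2], the value of [phi] at the centre is bounded by the [L^n] norm
    of [t^2 f].

    Let [M] be the supremum of [v - sup |v|_boundary], nearly attained at [o].
    The function [v - phi - M |y - y(o)|^2 / rho^2 - c G(dist(x, complement of X))]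
    with [G r = (2 A - r) r] and [A = 2 d0] has no interior maximum at points where
    [v - sup |v|_boundary >= M / 4], the compact part in question: [X] is convex, so
    at a maximum point the distance to the complement can be replaced by the
    distance to a supporting hyperplane, which makes the test function smooth and
    gives it [- 2 c] in [L]. Condition [G] bounds that distance by [d0], so that
    [c A^2 <= M / 4] for [rho] large, and [M <= 4 phi(o)] follows. *)

Set Implicit Arguments.
Unset Strict Implicit.
Unset Printing Implicit Defensive.
Import Order.TTheory GRing.Theory Num.Theory.
Import numFieldNormedType.Exports.
Local Open Scope classical_set_scope.
Local Open Scope ring_scope.

(** * Functions of class C^k *)
Section C_k_theory.
Context (R : realType) (V : normedModType R).
Implicit Types (D : set V) (u v : V -> R) (k : nat).

(** Restricting [u] to the line through [x] in direction [w] reduces this to the chain rule on the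
    reals, so that only the derivative along [w] enters. *)
Lemma is_derive_comp1 u (g : R -> R) (x w : V) (du dg : R) :
  is_derive x w u du -> is_derive (u x) 1 g dg ->
  is_derive x w (g \o u) (dg * du).
Proof.
move=> [ud udu] gd.
have line (f : V -> R) : 'D_w f x = 'D_1 (fun t : R => f (t *: w + x)) 0.
  rewrite /derive; set g1 := fun h => h^-1 *: _; set g2 := fun h => h^-1 *: _.
  suff -> : g1 = g2 by [].
  by apply/funext => t; rewrite /g1 /g2 /= addr0 scale0r add0r [_%:A]mulr1.
have gd' : is_derive ((fun t : R => u (t *: w + x)) 0) 1 g dg.
  by rewrite scale0r add0r.
have ud' : is_derive (0 : R) 1 (fun t : R => u (t *: w + x)) du.
  by split; [exact: (derivable1P u x w).1|rewrite -line].
have [gu guE] := is_derive1_comp gd' ud'.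
by split; [exact: (derivable1P (g \o u) x w).2|rewrite line guE].
Qed.

Lemma open_near_eq D u v x : open D -> D x -> (forall y, D y -> u y = v y) ->
  \near x, u x = v x.
Proof. by move=> oD Dx uv; apply: filterS (open_nbhs_nbhs (conj oD Dx)). Qed.

Lemma continuous_in_eq D u v : open D -> (forall x, D x -> u x = v x) ->
  continuous_in D u -> continuous_in D v.
Proof.
move=> oD uv cu x Dx; rewrite /prop_for /continuous_at -uv//.
apply: cvg_trans (cu x Dx); apply: near_eq_cvg.
by apply: (open_near_eq oD Dx) => y Dy; rewrite ?uv.
Qed.

Lemma C_k_eq k D u v : open D -> (forall x, D x -> u x = v x) ->
  C_k k D u -> C_k k D v.
Proof.
elim: k u v => [|k IHk] u v oD uv /= [cu du].
  by split => //; exact: continuous_in_eq cu.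
split=> [|w]; first exact: continuous_in_eq cu.
have [udw Cw] := du w; split => [x Dx|].
  exact: near_eq_derivable (open_near_eq oD Dx uv) (udw x Dx).
apply: IHk Cw => // x Dx.
exact: near_eq_derive (open_near_eq oD Dx uv).
Qed.

Lemma C_k_sub k D E u : D `<=` E -> C_k k E u -> C_k k D u.
Proof.
move=> DE; elim: k u => [|k IHk] u /= [cu du].
  by split => // x /DE; exact: cu.
split=> [x /DE|w]; first exact: cu.
by have [udw /IHk] := du w; split => // x /DE; exact: udw.
Qed.

Lemma C_kS k D u : C_k k.+1 D u -> C_k k D u.
Proof.
elim: k u => [|k IHk] u [cu du]; split => // w.
by have [udw /IHk] := du w.
Qed.

Lemma C_k_cont k D u : C_k k D u -> continuous_in D u.
Proof. by case: k => [|k] []. Qed.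

(** The form in which the closure properties are proved by induction: an explicit formula for the
    derivative, valid on [D], replaces ['D_w u]. *)
Lemma C_kS_is_derive k D u : open D -> continuous_in D u ->
  (forall w, exists2 du, forall x, D x -> is_derive x w u (du x) & C_k k D du) ->
  C_k k.+1 D u.
Proof.
move=> oD cu du; split=> // w; have [u' uu' Cu'] := du w.
split=> [x /uu'[]//|].
by apply: C_k_eq Cu' => // x /uu'[].
Qed.

Lemma C_k_is_derive k D u : C_k k.+1 D u ->
  forall w x, D x -> is_derive x w u ('D_w u x).
Proof. by move=> [_ du] w x Dx; have [udw _] := du w; split => //; exact: udw. Qed.

Lemma C_k_cst k D (c : R) : open D -> C_k k D (fun=> c).
Proof.
elim: k c => [|k IHk] c oD; first by split => // x _; exact: cvg_cst.
apply: C_kS_is_derive => // [x _|w]; first exact: cvg_cst.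
by exists (fun=> 0); [move=> x _; exact: is_derive_cst|exact: IHk].
Qed.

Lemma C_kD k D u v : open D -> C_k k D u -> C_k k D v ->
  C_k k D (fun x => u x + v x).
Proof.
elim: k u v => [|k IHk] u v oD Cu Cv.
  by split => // x Dx; apply: cvgD; [exact: Cu.1|exact: Cv.1].
apply: C_kS_is_derive => // [x Dx|w].
  by apply: cvgD; [exact: Cu.1|exact: Cv.1].
exists (fun x => 'D_w u x + 'D_w v x) => [x Dx|].
  exact: is_deriveD (C_k_is_derive Cu w Dx) (C_k_is_derive Cv w Dx).
by apply: IHk => //; [case: Cu => _ /(_ w)[]|case: Cv => _ /(_ w)[]].
Qed.

Lemma C_kM k D u v : open D -> C_k k D u -> C_k k D v ->
  C_k k D (fun x => u x * v x).
Proof.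
elim: k u v => [|k IHk] u v oD Cu Cv.
  by split => // x Dx; apply: cvgM; [exact: Cu.1|exact: Cv.1].
apply: C_kS_is_derive => // [x Dx|w].
  by apply: cvgM; [exact: Cu.1|exact: Cv.1].
exists (fun x => u x * 'D_w v x + v x * 'D_w u x) => [x Dx|].
  exact: is_deriveM (C_k_is_derive Cu w Dx) (C_k_is_derive Cv w Dx).
apply: C_kD => //; apply: IHk => //; try exact: C_kS;
  by [case: Cu => _ /(_ w)[]|case: Cv => _ /(_ w)[]].
Qed.

Lemma C_kZ k D (c : R) u : open D -> C_k k D u -> C_k k D (fun x => c * u x).
Proof. by move=> oD Cu; apply: C_kM => //; exact: C_k_cst. Qed.

Lemma C_k_sum k D (I : Type) (r : seq I) (u : I -> V -> R) :
  open D -> (forall i, C_k k D (u i)) -> C_k k D (fun x => \sum_(i <- r) u i x).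
Proof.
move=> oD Cu; elim: r => [|i r IHr].
  by apply: C_k_eq (C_k_cst k 0 oD) => // x _; rewrite big_nil.
apply: C_k_eq (C_kD oD (Cu i) IHr) => // x _; by rewrite big_cons.
Qed.

Lemma C_k_exp k D u : open D -> C_k k D u -> C_k k D (fun x => expR (u x)).
Proof.
move=> oD; elim: k u => [|k IHk] u Cu.
  split => // x Dx; apply: (@continuous_comp _ _ _ u expR).
    exact: C_k_cont Cu _ Dx.
  exact: continuous_expR.
apply: C_kS_is_derive => // [x Dx|w].
  apply: (@continuous_comp _ _ _ u expR); first exact: C_k_cont Cu _ Dx.
  exact: continuous_expR.
exists (fun x => expR (u x) * 'D_w u x) => [x Dx|].
  exact: is_derive_comp1 (C_k_is_derive Cu w Dx) (is_derive_expR _).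
apply: C_kM => //; first exact/IHk/C_kS.
by case: Cu => _ /(_ w)[].
Qed.

Lemma C_k_inv k D u : open D -> (forall x, D x -> u x != 0) ->
  C_k k D u -> C_k k D (fun x => (u x)^-1).
Proof.
move=> oD u0; elim: k => [|k IHk] Cu.
  by split => // x Dx; apply: cvgV; [exact: u0|exact: C_k_cont Cu _ Dx].
apply: C_kS_is_derive => // [x Dx|w].
  by apply: cvgV; [exact: u0|exact: C_k_cont Cu _ Dx].
exists (fun x => (-1) * ((u x)^-1 * (u x)^-1) * 'D_w u x) => [x Dx|].
  have du := C_k_is_derive Cu w Dx.
  split; first by apply: derivableV; [exact: u0|case: du].
  rewrite deriveV; [|exact: u0|by case: du].
  by rewrite mulN1r -invfM -expr2.
apply: C_kM => //; last by case: Cu => _ /(_ w)[].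
by apply: C_kZ => //; apply: C_kM => //; exact/IHk/C_kS.
Qed.

Lemma C_k_ln k D u : open D -> (forall x, D x -> 0 < u x) ->
  C_k k D u -> C_k k D (fun x => ln (u x)).
Proof.
move=> oD u0; have cln : C_k k D u -> continuous_in D (fun x => ln (u x)).
  move=> Cu x Dx; apply: (@continuous_comp _ _ _ u (@ln R)).
    exact: C_k_cont Cu _ Dx.
  by apply: continuous_ln; exact: u0.
(* A case distinction takes the place of an induction: one derivative turns [ln] into an inverse,
   which [C_k_inv] covers at every order. *)
case: k cln => [|k] cln Cu; first by split => //; exact: cln.
apply: C_kS_is_derive => // [|w]; first exact: cln.
exists (fun x => (u x)^-1 * 'D_w u x) => [x Dx|].
  exact: is_derive_comp1 (C_k_is_derive Cu w Dx) (is_derive1_ln (u0 _ Dx)).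
apply: C_kM => //; last by case: Cu => _ /(_ w)[].
apply: C_k_inv => // [x Dx|]; first by rewrite gt_eqF// u0.
exact: C_kS.
Qed.

Lemma is_derive_affine u x w (c : R) :
  (forall h : R, u (h *: w + x) = h * c + u x) -> is_derive x w u c.
Proof.
move=> uE; have cvgc : (fun h : R => h^-1 *: ((u \o shift x) (h *: w) - u x)) @ 0^' --> c.
  apply: cvg_near_cst; near=> h.
  have h0 : h != 0 by near: h; exact: nbhs_dnbhs_neq.
  by rewrite /= uE addrK /GRing.scale /= mulKf.
split; first by apply/cvg_ex; exists c.
exact: cvg_lim cvgc.
Unshelve. all: by end_near. Qed.

End C_k_theory.

(** * Calculus in logarithmic coordinates *)
Section cone_calculus.
Context (R : realType) (m : nat).

Local Notation pt := (R * 'rV[R]_m)%type.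
Implicit Types (p q : pt) (u v : pt -> R) (i j : 'I_m.+1).

(** The logarithmic coordinates of the cone, in which [cone_field i] is the partial derivative along
    the coordinate [i]; see [is_field_coord]. *)
Definition cone_coord i p : R :=
  if unlift ord0 i is Some j then p.2 0 j else ln p.1.

Definition half_space : set pt := [set p | 0 < p.1].

Lemma open_half_space : open half_space.
Proof.
rewrite (_ : half_space = fst @^-1` [set x : R | 0 < x]) //.
apply: open_comp => [p _|]; first exact: cvg_fst.
exact: open_gt.
Qed.

Definition cone_dir i : pt :=
  if unlift ord0 i is Some j then (0, delta_mx 0 j) else (1, 0).

Definition cone_weight i p : R := if i == ord0 then p.1 else 1.

Lemma cone_fieldE i u p :
  cone_field i u p = cone_weight i p * 'D_(cone_dir i) u p.
Proof.
rewrite /cone_field /cone_weight /cone_dir.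
by case: unliftP => [j ->|->]; rewrite ?eqxx ?mul1r.
Qed.

(** Derivability is part of the notion because [cone_field] has a value even where the derivative
    does not exist, and the calculus rules below rest on it. *)
Definition is_field i u u' :=
  forall p, half_space p -> derivable u p (cone_dir i) /\ cone_field i u p = u' p.

Lemma is_field_eqr i u u' v' : (forall p, half_space p -> u' p = v' p) ->
  is_field i u u' -> is_field i u v'.
Proof. by move=> uv uu' p Hp; have [? ->] := uu' p Hp; split => //; exact: uv. Qed.

Lemma is_field_is_derive i u p (c d : R) :
  is_derive p (cone_dir i) u c -> cone_weight i p * c = d ->
  derivable u p (cone_dir i) /\ cone_field i u p = d.
Proof. by move=> [? dc] <-; split => //; rewrite cone_fieldE dc. Qed.

Lemma is_field_cst i (c : R) : is_field i (fun=> c) (fun=> 0).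
Proof.
by move=> p Hp; apply: is_field_is_derive (is_derive_cst _ _ _) _ => //; rewrite mulr0.
Qed.

Lemma is_fieldD i u v u' v' : is_field i u u' -> is_field i v v' ->
  is_field i (fun p => u p + v p) (fun p => u' p + v' p).
Proof.
move=> uu' vv' p Hp; have [du <-] := uu' p Hp; have [dv <-] := vv' p Hp.
apply: is_field_is_derive (is_deriveD (derivableP du) (derivableP dv)) _ => //.
by rewrite mulrDr -!cone_fieldE.
Qed.

Lemma is_fieldM i u v u' v' : is_field i u u' -> is_field i v v' ->
  is_field i (fun p => u p * v p) (fun p => u p * v' p + v p * u' p).
Proof.
move=> uu' vv' p Hp; have [du <-] := uu' p Hp; have [dv <-] := vv' p Hp.
apply: is_field_is_derive (is_deriveM (derivableP du) (derivableP dv)) _ => //.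
by rewrite !cone_fieldE mulrDr /GRing.scale /= !(mulrCA (cone_weight i p)).
Qed.

Lemma is_fieldZ i (c : R) u u' : is_field i u u' ->
  is_field i (fun p => c * u p) (fun p => c * u' p).
Proof.
move=> uu'; apply: is_field_eqr (is_fieldM (is_field_cst i c) uu').
by move=> p _; rewrite mulr0 addr0.
Qed.

Lemma is_field_sum i (I : Type) (r : seq I) (u u' : I -> pt -> R) :
  (forall k, is_field i (u k) (u' k)) ->
  is_field i (fun p => \sum_(k <- r) u k p) (fun p => \sum_(k <- r) u' k p).
Proof.
move=> uu'; elim: r => [|k r IHr].
  rewrite (_ : (fun p => _) = fun=> 0); last first.
    by apply/funext => p; rewrite big_nil.
  by apply: is_field_eqr (is_field_cst i 0) => p _; rewrite big_nil.
rewrite (_ : (fun p => _) = fun p => u k p + \sum_(k <- r) u k p); last first.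
  by apply/funext => p; rewrite big_cons.
by apply: is_field_eqr (is_fieldD (uu' k) IHr) => p _; rewrite big_cons.
Qed.

Lemma is_field_exp i u u' : is_field i u u' ->
  is_field i (fun p => expR (u p)) (fun p => expR (u p) * u' p).
Proof.
move=> uu' p Hp; have [du <-] := uu' p Hp.
apply: is_field_is_derive (is_derive_comp1 (derivableP du) (is_derive_expR _)) _ => //.
by rewrite !cone_fieldE mulrCA.
Qed.

Lemma is_field_ln i u u' : (forall p, half_space p -> 0 < u p) ->
  is_field i u u' -> is_field i (fun p => ln (u p)) (fun p => (u p)^-1 * u' p).
Proof.
move=> u0 uu' p Hp; have [du <-] := uu' p Hp.
have lnd := is_derive1_ln (u0 p Hp).
apply: is_field_is_derive (is_derive_comp1 (derivableP du) lnd) _ => //.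
by rewrite !cone_fieldE mulrCA.
Qed.

Lemma is_field_inv i u u' : (forall p, half_space p -> 0 < u p) ->
  is_field i u u' -> is_field i (fun p => (u p)^-1) (fun p => - (u p) ^- 2 * u' p).
Proof.
move=> u0 uu' p Hp; have [du <-] := uu' p Hp.
have un0 : u p != 0 by rewrite gt_eqF// u0.
split; first exact: derivableV.
by rewrite !cone_fieldE deriveV// mulrCA.
Qed.

Lemma fst_shift (h : R) (w p : pt) : (h *: w + p).1 = h * w.1 + p.1.
Proof. by []. Qed.

Lemma snd_shift (h : R) (w p : pt) (j : 'I_m) :
  (h *: w + p).2 0 j = h * w.2 0 j + p.2 0 j.
Proof. by rewrite /= !mxE. Qed.

Lemma is_field_coord i j : is_field i (cone_coord j) (fun=> (j == i)%:R).
Proof.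
move=> p Hp; rewrite /cone_coord; case: (unliftP ord0 j) => [j' ->|->].
  apply: is_field_is_derive => //.
    by apply: is_derive_affine => h; exact: snd_shift.
  rewrite /cone_weight /cone_dir; case: (unliftP ord0 i) => [i' ->|->] /=.
    by rewrite mul1r !mxE (inj_eq lift_inj).
  by rewrite !mxE mulr0.
have dfst : is_derive p (cone_dir i) (fun q : pt => q.1) (cone_dir i).1.
  by apply: is_derive_affine => h; exact: fst_shift.
apply: is_field_is_derive (is_derive_comp1 dfst (is_derive1_ln Hp)) _ => //.
rewrite /cone_weight /cone_dir; case: (unliftP ord0 i) => [i' ->|->] /=.
  by rewrite !mulr0.
by rewrite ?eqxx mulr1 mulfV// gt_eqF.
Qed.

Lemma C_k_affine (V : normedModType R) k (D : set V) (u c : V -> R) : open D ->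
  continuous_in D u -> (forall h w x, u (h *: w + x) = h * c w + u x) ->
  C_k k D u.
Proof.
case: k => [|k] oD cu uE; first by split.
apply: C_kS_is_derive => // w; exists (fun=> c w); last exact: C_k_cst.
by move=> x _; apply: is_derive_affine => h; exact: uE.
Qed.

Lemma C_k_coord k i : C_k k half_space (cone_coord i).
Proof.
have oH := @open_half_space.
rewrite /cone_coord; case: (unliftP ord0 i) => [j _|_] /=.
  have cj : continuous_in half_space (fun p : pt => p.2 0 j).
    move=> p Hp; apply: (@continuous_comp _ _ _ (@snd R _) (fun x : 'rV[R]_m => x 0 j)).
      exact: cvg_snd.
    exact: coord_continuous.
  exact: (C_k_affine k oH cj (fun h w x => snd_shift h w x j)).
have c1 : continuous_in half_space (@fst R 'rV[R]_m).
  by move=> p _; exact: cvg_fst.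
by apply: C_k_ln => //; exact: (C_k_affine k oH c1 fst_shift).
Qed.

Implicit Types (d e : 'I_m.+1 -> pt -> R).

(** [d1] is the gradient and [d2] the diagonal of the Hessian in logarithmic coordinates; the
    operator involves no mixed derivative. *)
Definition second_order u d1 d2 :=
  [/\ C_k 2 half_space u, forall i, is_field i u (d1 i) &
      forall i, is_field i (d1 i) (d2 i)].

Lemma second_order_operator u d1 d2 p : second_order u d1 d2 -> half_space p ->
  p.1 ^+ 2 * cone_operator u p =
  \sum_i d2 i p + (m.+1%:R - 2) * d1 ord0 p.
Proof.
move=> [_ uu1 u12] Hp; have p0 : p.1 != 0 by rewrite gt_eqF.
rewrite /cone_operator -[X in _ + X]mulrA -mulrDr mulVKf ?expf_neq0//.
congr (_ + _ * _); last by have [_ ->] := uu1 ord0 p Hp.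
rewrite /cone_laplacian /mxtrace; apply: eq_bigr => i _; rewrite mxE.
have [_ <-] := u12 i p Hp; rewrite !cone_fieldE; congr (_ * _).
(* [cone_field i u] and [d1 i] agree only on the half-space; being open, it contains a neighbourhood
   of [p], which determines the outer derivative. *)
apply: near_eq_derive; apply: filterS (open_nbhs_nbhs (conj open_half_space Hp)).
by move=> q Hq; have [_ ->] := uu1 i q Hq.
Qed.

Lemma second_orderD u d1 d2 v e1 e2 :
  second_order u d1 d2 -> second_order v e1 e2 ->
  second_order (fun p => u p + v p) (fun i p => d1 i p + e1 i p)
    (fun i p => d2 i p + e2 i p).
Proof.
move=> [Cu du du1] [Cv dv dv1]; split=> [|i|i].
- by apply: C_kD => //; exact: open_half_space.
- exact: is_fieldD.
- exact: is_fieldD.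
Qed.

Lemma second_orderZ (c : R) u d1 d2 : second_order u d1 d2 ->
  second_order (fun p => c * u p) (fun i p => c * d1 i p) (fun i p => c * d2 i p).
Proof.
move=> [Cu du du1]; split=> [|i|i].
- by apply: C_kZ => //; exact: open_half_space.
- exact: is_fieldZ.
- exact: is_fieldZ.
Qed.

Lemma second_order_sum (I : Type) (r : seq I) (u : I -> pt -> R)
    (d1 d2 : I -> 'I_m.+1 -> pt -> R) :
  (forall k : I, second_order (u k) (d1 k) (d2 k)) ->
  second_order (fun p => \sum_(k <- r) u k p)
    (fun i p => \sum_(k <- r) d1 k i p) (fun i p => \sum_(k <- r) d2 k i p).
Proof.
move=> du; split=> [|i|i].
- by apply: C_k_sum => [|k]; [exact: open_half_space|have [] := du k].
- by apply: is_field_sum => k; have [] := du k.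
- apply: (@is_field_sum i _ _ (fun k => d1 k i) (fun k => d2 k i)) => k.
  by have [_ _] := du k.
Qed.

(** The squared cone distance to a point that is given by its logarithmic coordinates, as are the
    corners of the grid used below. *)
Definition sq_dist (c : 'I_m.+1 -> R) p : R := \sum_i (cone_coord i p - c i) ^+ 2.

Lemma second_order_sq_dist c :
  second_order (sq_dist c) (fun i p => 2 * (cone_coord i p - c i)) (fun _ _ => 2).
Proof.
split=> [|i|i].
- rewrite /sq_dist; apply: C_k_sum => [|i]; first exact: open_half_space.
  have CB : C_k 2 half_space (fun p => cone_coord i p - c i).
    apply: C_kD; [exact: open_half_space|exact: C_k_coord|].
    by apply: C_k_cst; exact: open_half_space.
  by apply: C_kM => //; exact: open_half_space.
- have dB j : is_field i (fun p => cone_coord j p - c j) (fun p => (j == i)%:R + 0).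
    exact: is_fieldD (is_field_coord _ _) (is_field_cst _ _).
  apply: is_field_eqr (is_field_sum _ (fun j => is_fieldM (dB j) (dB j))).
  move=> p _ /=; rewrite (bigD1 i)//= eqxx big1 => [|j /negPf ->] /=; by ring.
- apply: is_field_eqr
    (is_fieldZ 2 (is_fieldD (is_field_coord i i) (is_field_cst i (- c i)))).
  by move=> p _; rewrite eqxx addr0 mulr1.
Qed.

Definition affine_coord (a : 'I_m.+1 -> R) (c : R) p : R :=
  \sum_i a i * cone_coord i p + c.

Lemma C_k_affine_coord k a c : C_k k half_space (affine_coord a c).
Proof.
have oH := @open_half_space.
apply: C_kD => //; last exact: C_k_cst.
by apply: C_k_sum => // i; apply: C_kZ => //; exact: C_k_coord.
Qed.

(** For a unit vector [a] the second derivatives add up to [-2], which is the strictness that the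
    maximum principle draws on. *)
Lemma second_order_parabola (A : R) a c :
  second_order (fun p => (2 * A - affine_coord a c p) * affine_coord a c p)
    (fun i p => 2 * a i * (A - affine_coord a c p)) (fun i p => - 2 * a i ^+ 2).
Proof.
have dl i : is_field i (affine_coord a c) (fun=> a i).
  apply: is_field_eqr (is_fieldD (is_field_sum (index_enum _)
    (fun j => is_fieldZ (a j) (is_field_coord i j))) (is_field_cst i c)).
  move=> p _ /=; rewrite (bigD1 i)//= eqxx big1 => [|j /negPf ->] /=; by ring.
have dAl i : is_field i (fun p => 2 * A - affine_coord a c p) (fun=> - a i).
  rewrite (_ : (fun p => _) = fun p => 2 * A + (-1) * affine_coord a c p).
    apply: is_field_eqr (is_fieldD (is_field_cst i _) (is_fieldZ (-1) (dl i))).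
    by move=> p _; rewrite add0r mulN1r.
  by apply/funext => p; rewrite mulN1r.
have Cl := C_k_affine_coord 2 a c.
split=> [|i|i].
- have oH := @open_half_space.
  have CNl := C_kZ (-1) oH Cl.
  have CAl : C_k 2 half_space (fun p => 2 * A - affine_coord a c p).
    apply: C_k_eq (C_kD oH (C_k_cst 2 (2 * A) oH) CNl) => // p _.
    by rewrite mulN1r.
  exact: (C_kM oH CAl Cl).
- by apply: is_field_eqr (is_fieldM (dAl i) (dl i)) => p _; ring.
- have -> : (fun p => 2 * a i * (A - affine_coord a c p)) =
    fun p => 2 * a i * (A + (-1) * affine_coord a c p).
    by apply/funext => p; ring.
  apply: is_field_eqr (is_fieldZ _ (is_fieldD (is_field_cst i A)
    (is_fieldZ (-1) (dl i)))) => p _; ring.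
Qed.

End cone_calculus.

(** * The kernel *)
Section kernel.
Context (R : realType) (m : nat).
Local Notation pt := (R * 'rV[R]_m)%type.
Implicit Types (p q : pt) (c : 'I_m.+1 -> R) (e : R).

Local Notation b := (m.+1%:R - 2 : R).

(* [exp (- b z_0 / 2) * (e + |z|^2) ^ (- b / 2)] with [z = y - c]; the first factor
   absorbs the drift term. *)
Definition cone_kernel e c p : R :=
  expR (- (b / 2) * ((cone_coord ord0 p - c ord0) + ln (e + sq_dist c p))).

(** The logarithmic derivative of [cone_kernel] in direction [i]. *)
Definition kernel_slope e c (i : 'I_m.+1) p : R :=
  - (b / 2) * ((ord0 == i)%:R + (e + sq_dist c p)^-1 * (2 * (cone_coord i p - c i))).

Lemma sq_dist_ge0 c p : 0 <= sq_dist c p.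
Proof. by apply: sumr_ge0 => i _; exact: sqr_ge0. Qed.

Lemma second_order_kernel e c : 0 < e ->
  second_order (cone_kernel e c)
    (fun i p => cone_kernel e c p * kernel_slope e c i p)
    (fun i p => cone_kernel e c p * (kernel_slope e c i p ^+ 2
       - b / 2 * (2 / (e + sq_dist c p) -
         4 * (cone_coord i p - c i) ^+ 2 / (e + sq_dist c p) ^+ 2))).
Proof.
move=> e0; have oH := @open_half_space R m.
have Q0 p : half_space p -> 0 < e + sq_dist c p.
  by move=> _; rewrite ltr_wpDr// sq_dist_ge0.
have [Cq dq ddq] := second_order_sq_dist c.
have dQ i : is_field i (fun p => e + sq_dist c p) (fun p => 2 * (cone_coord i p - c i)).
  apply: is_field_eqr (is_fieldD (is_field_cst i e) (dq i)) => p _.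
  by rewrite add0r.
have dg i : is_field i
    (fun p => - (b / 2) * ((cone_coord ord0 p - c ord0) + ln (e + sq_dist c p)))
    (kernel_slope e c i).
  apply: is_field_eqr (is_fieldZ (- (b / 2)) (is_fieldD (is_fieldD
    (is_field_coord i ord0) (is_field_cst i (- c ord0))) (is_field_ln Q0 (dQ i)))).
  by move=> p _; rewrite addr0.
have dk i : is_field i (cone_kernel e c)
    (fun p => cone_kernel e c p * kernel_slope e c i p).
  exact: is_field_exp (dg i).
split; [|exact: dk|move=> i].
  have Cc (a : R) := C_k_cst 2 a oH.
  have C0 := C_kD oH (C_k_coord R 2 (@ord0 m)) (Cc (- c ord0)).
  have CQ := C_k_ln oH Q0 (C_kD oH (Cc e) Cq).
  exact: (C_k_exp oH (C_kZ (- (b / 2)) oH (C_kD oH C0 CQ))).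
have ds := is_fieldZ (- (b / 2)) (is_fieldD (is_field_cst i (ord0 == i)%:R)
  (is_fieldM (is_field_inv Q0 (dQ i)) (ddq i))).
apply: is_field_eqr (is_fieldM (dk i) ds) => p Hp /=.
rewrite /kernel_slope; set Q := e + _; have QN0 : Q != 0 by rewrite gt_eqF ?Q0.
by field.
Qed.

(** The factor [exp (- b z_0 / 2)] turns [Delta + b d/dz_0] into [Delta - b ^ 2 / 4]. As [b + 2] is
    the dimension [m.+1], the Laplacian of [(e + |z|^2)^(- b / 2)] is
    [- b (b + 2) e (e + |z|^2)^(- b / 2 - 2)], the regularised form of the harmonicity of
    [|z|^(- b)]. *)
Lemma cone_operator_kernel e c p : 0 < e -> half_space p ->
  p.1 ^+ 2 * cone_operator (cone_kernel e c) p =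
  - cone_kernel e c p * (b ^+ 2 / 4 + b * m.+1%:R * e / (e + sq_dist c p) ^+ 2).
Proof.
move=> e0 Hp; rewrite (second_order_operator (second_order_kernel c e0) Hp).
have Q0 : 0 < e + sq_dist c p by rewrite ltr_wpDr// sq_dist_ge0.
have QN0 : e + sq_dist c p != 0 by rewrite gt_eqF.
rewrite -mulr_sumr mulrCA -mulrDr mulNr -mulrN; congr (_ * _).
set Q := e + _ in Q0 QN0 *.
(* Each summand is sorted by powers of [z_i]. The term linear in [z_0] cancels with the drift, and
   the multiples of [1 / Q] cancel since [b + 2 = m.+1]. *)
under eq_bigr => i _.
  rewrite (_ : _ - _ = (b ^+ 2 / 4 * (ord0 == i)%:R
    + b ^+ 2 / Q * ((ord0 == i)%:R * (cone_coord i p - c i)))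
    + ((b ^+ 2 / Q ^+ 2 + 2 * b / Q ^+ 2) * (cone_coord i p - c i) ^+ 2 - b / Q)).
    over.
  rewrite /kernel_slope -/Q; case: eqP => _ /=; by field.
rewrite !big_split /= -!mulr_sumr sumr_const card_ord -/(sq_dist c p).
rewrite (bigD1 ord0)//= big1 ?addr0; last by move=> i /negPf; rewrite eq_sym => ->.
rewrite (bigD1 ord0)//= big1 ?addr0; last first.
  by move=> i /negPf; rewrite eq_sym => ->; rewrite mul0r.
rewrite -[_ *+ m.+1]mulr_natr /kernel_slope eqxx -/Q /=.
have -> : sq_dist c p = Q - e by rewrite /Q addrC addKr.
by field.
Qed.

End kernel.

(** * Counting grid points *)
(** The distance [|a - J|]: at least one of the two truncated differences is zero. *)
Definition offset (J a : nat) : nat := ((a - J) + (J - a))%N.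

(** The sup-norm distance of the multi-index [k] from the centre [(J, ..., J)] of the grid. *)
Definition shell (n J : nat) (k : {ffun 'I_n -> 'I_(2 * J)}) : nat :=
  \max_i offset J (k i).

Lemma card_offset_le (J s : nat) :
  (#|[pred a : 'I_(2 * J) | offset J a <= s]| <= s.*2.+1)%N.
Proof.
pose f (a : 'I_(2 * J)) : 'I_s.*2.+1 := inord (a + s - J).
rewrite -[leqRHS]card_ord -(card_in_imset (f := f)).
  exact: max_card.
move=> a b; rewrite !inE /offset => Ha Hb /(congr1 val) /=.
rewrite !inordK; [move=> ab; apply: val_inj => /=; lia|lia|lia].
Qed.

Lemma card_offset_eq (J s : nat) :
  (#|[pred a : 'I_(2 * J) | offset J a == s]| <= 2)%N.
Proof.
rewrite -[leqRHS]card_bool -(card_in_imset (f := fun a : 'I_(2 * J) => (a < J)%N)).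
  exact: max_card.
move=> a b; rewrite !inE /offset => /eqP Ha /eqP Hb ab.
apply: val_inj => /=; move: ab; case: ltnP; case: ltnP => //; lia.
Qed.

(** Some coordinate of a point of the shell has offset exactly [s], which leaves at most two values
    for it; every other coordinate has at most [2 s + 1] values. The factor [m.+1] counts the choice
    of that coordinate. *)
Lemma card_shell (m J s : nat) :
  (#|[pred k : {ffun 'I_m.+1 -> 'I_(2 * J)} | shell k == s]| <=
   m.+1 * (2 * s.*2.+1 ^ m))%N.
Proof.
pose F (i l : 'I_m.+1) : pred 'I_(2 * J) :=
  [pred a : 'I_(2 * J) |
    if l == i then offset J a == s else (offset J a <= s)%N].
have sub : [set k : {ffun 'I_m.+1 -> 'I_(2 * J)} | shell k == s]%SET \subset
    (\bigcup_(i : 'I_m.+1) [set k | k \in family (F i)])%SET.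
  apply/fintype.subsetP => k; rewrite inE => /eqP ks.
  have [i _ ik] : {i | i \in 'I_m.+1 & shell k = offset J (k i)}.
    by apply: eq_bigmax_cond; rewrite card_ord.
  apply/bigcupP; exists i => //; rewrite inE; apply/familyP => l; rewrite /F.
  rewrite inE; case: eqP => [->|_]; rewrite -ks ?ik//.
  rewrite -ik; exact: (leq_bigmax (F := fun i => offset J (k i)) l).
have <- : #|[set k : {ffun 'I_m.+1 -> 'I_(2 * J)} | shell k == s]%SET| =
    #|[pred k : {ffun 'I_m.+1 -> 'I_(2 * J)} | shell k == s]|.
  by apply: eq_card => k; rewrite !inE.
apply: leq_trans (subset_leq_card sub) _.
apply: (@leq_trans (\sum_(i : 'I_m.+1) #|[set k | k \in family (F i)]%SET|)%N).
  apply: (big_ind2 (fun (A : {set {ffun 'I_m.+1 -> 'I_(2 * J)}}) a => #|A| <= a)%N).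
  - by rewrite cards0.
  - move=> A a B b Aa Bb.
    exact: leq_trans (leq_card_setU A B).1 (leq_add Aa Bb).
  - by [].
rewrite -[X in (_ <= X * _)%N]card_ord -sum_nat_const; apply: leq_sum => i _.
rewrite cardsE card_family foldrE big_map big_enum /= (bigD1 i)//=.
apply: leq_mul.
  rewrite (eq_card (B := [pred a : 'I_(2 * J) | offset J a == s])).
    exact: card_offset_eq.
  by move=> a; rewrite !inE eqxx.
apply: leq_trans (_ : \prod_(l < m.+1 | l != i) s.*2.+1 <= _)%N.
  apply: leq_prod => l /negPf li.
  rewrite (eq_card (B := [pred a : 'I_(2 * J) | (offset J a <= s)%N])).
    exact: card_offset_le.
  by move=> a; rewrite !inE li.
by rewrite prod_nat_const cardC1 card_ord.
Qed.

Lemma shell_le (n J : nat) (k : {ffun 'I_n -> 'I_(2 * J)}) : (shell k <= J)%N.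
Proof. by apply/bigmax_leqP => i _; rewrite /offset; have := ltn_ord (k i); lia. Qed.

(** The exponent is one less than the dimension, so each shell contributes at most the constant
    [m.+1 * 2 ^ m.+1], and there are [J + 1 <= 2 J] shells. *)
Lemma sum_shell (R : realType) (m J : nat) : (0 < J)%N ->
  \sum_(k : {ffun 'I_m.+1 -> 'I_(2 * J)}) ((shell k).+1%:R ^- m : R) <=
  (m.+1 * 2 ^ m.+1 * 2)%N%:R * J%:R.
Proof.
move=> J0.
rewrite (partition_big (fun k => inord (shell k) : 'I_J.+1) xpredT)//=.
apply: le_trans (_ : \sum_(s < J.+1) (m.+1 * 2 ^ m.+1)%N%:R <= _); last first.
  rewrite sumr_const card_ord -[_ *+ J.+1]mulr_natr -natrM.
  rewrite -[X in _ <= X]natrM ler_nat -[leqRHS]mulnA leq_mul2l.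
  by apply/orP; right; lia.
apply: ler_sum => s _.
apply: le_trans (_ : \sum_(k : {ffun 'I_m.+1 -> 'I_(2 * J)} | shell k == s)
    (s.+1%:R ^- m : R) <= _).
  rewrite le_eqVlt; apply/orP; left; apply/eqP.
  have eqs k : ((inord (@shell m.+1 J k) : 'I_J.+1) == s) = (shell k == s).
    by rewrite -val_eqE /= inordK// ltnS shell_le.
  by rewrite (eq_bigl _ _ eqs); apply: eq_bigr => k /eqP ->.
rewrite sumr_const -[_ *+ #|_|]mulr_natr mulrC ler_pdivrMr ?exprn_gt0//.
rewrite -natrX -natrM ler_nat; apply: leq_trans (card_shell m J s) _.
rewrite -!mulnA leq_mul2l expnS -!mulnA leq_mul2l -expnMn /=.
case: {+}m => // m'; rewrite leq_exp2r//; lia.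
Qed.

(** * Lower bound for the cone integral *)
(** Monotonicity is taken from the definition of the integral as a supremum over simple functions
    below, so that it applies to an integrand whose measurability is not known. *)
Lemma le_integral_step d (T : measurableType d) (R : realType)
    (mu : {measure set T -> \bar R}) (D : set T) (f : T -> \bar R)
    (I : finType) (a : I -> R) (A : I -> set T) :
  (forall k, 0 <= a k) -> (forall k, measurable (A k)) ->
  (forall x, D x -> (0 <= f x)%E) ->
  (forall x, ((\sum_k a k * \1_(A k) x)%:E <= (f \_ D) x)%E) ->
  (\sum_k (a k)%:E * mu (A k) <= \int[mu]_(x in D) f x)%E.
Proof.
move=> a0 mA f0 af.
pose g k (x : T) : R := a k * \1_(A k) x.
have meas k : measurable_fun setT (EFin \o g k).
  by apply/measurable_EFinP/measurable_funM => //; exact: measurable_indic.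
have sE : (\sum_k (a k)%:E * mu (A k) = \int[mu]_x (\sum_k g k x)%:E)%E.
  rewrite (eq_integral (fun x => \sum_k (EFin \o g k) x)%E); last first.
    by move=> x _; rewrite sumEFin.
  rewrite (ge0_integral_sum mu measurableT); last 2 first.
  - by move=> k; exact: meas.
  - by move=> k x _; rewrite lee_fin mulr_ge0.
  apply: eq_bigr => k _.
  rewrite (eq_integral (fun x => (a k)%:E * (\1_(A k) x)%:E)%E)//.
  rewrite ge0_integralZl//; last first.
  - by rewrite lee_fin.
  - by apply/measurable_EFinP; exact: measurable_indic.
  by rewrite integral_indic// setIT.
rewrite sE ge0_integralTE; last first.
  by move=> x; rewrite lee_fin; apply: sumr_ge0 => k _; rewrite mulr_ge0.
rewrite ge0_integralE//; apply: le_ereal_sup => _ [h hs <-]; exists h => // x.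
exact: le_trans (hs x) (af x).
Qed.

Lemma lebesgue_measure_co (R : realType) (x y : R) : x < y ->
  lebesgue_measure ([set` `[x, y[] : set (measurableTypeR R)) = (y - x)%:E.
Proof. by move=> xy; have := lebesgue_measure_itv `[x, y[; rewrite /= lte_fin xy. Qed.

Section cells.
Context (R : realType) (m : nat).
Local Notation pt := (R * 'rV[R]_m)%type.

(** Half-open, so that the cells of a grid are disjoint. *)
Definition cone_cell (c : 'I_m.+1 -> R) (s : R) : set pt :=
  [set q | 0 < q.1 /\ forall i, c i <= cone_coord i q < c i + s].

Definition cone_box (c : 'I_m.+1 -> R) (s : R) :
    set (measurableTypeR R * m.-tuple (measurableTypeR R)) :=
  [set` `[expR (c ord0), expR (c ord0 + s)[] `*`
  [set x | forall j, [set` `[c (lift ord0 j), c (lift ord0 j) + s[] (tnth x j)].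

Lemma cone_boxE c s : cone_box c s = @pt_of R m @^-1` cone_cell c s.
Proof.
apply/seteqP; split=> -[t x]; rewrite /cone_box /cone_cell /= in_itv /=.
  move=> [/andP[ct tc] cx]; have t0 : 0 < t by exact: lt_le_trans (expR_gt0 _) ct.
  split=> // i; rewrite /cone_coord /=; case: (unliftP ord0 i) => [j ->|->].
    by have := cx j; rewrite in_itv/= mxE.
  by rewrite -ler_expR -ltr_expR lnK ?posrE// ct.
move=> [t0 cx]; split.
  have := cx ord0; rewrite /cone_coord unlift_none /=.
  by rewrite -ler_expR -ltr_expR lnK ?posrE.
by move=> j; have := cx (lift ord0 j); rewrite /cone_coord liftK /= mxE in_itv.
Qed.

Lemma measurable_tuple_box c s : measurable ([set x |
    forall j, [set` `[c (lift ord0 j), c (lift ord0 j) + s[] (tnth x j)] :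
  set (m.-tuple (measurableTypeR R))).
Proof.
rewrite (_ : [set x | _] = \bigcap_(j in [set: 'I_m])
    ((fun x : m.-tuple (measurableTypeR R) => tnth x j) @^-1`
      [set` `[c (lift ord0 j), c (lift ord0 j) + s[])); last first.
  by apply/seteqP; split=> [x Ax i _|x Ax i]; exact: Ax.
apply: fin_bigcap_measurable => [|i _]; first exact: finite_finset.
rewrite -[X in measurable X]setTI.
by apply: (@measurable_tnth _ (measurableTypeR R) m i) => //; exact: measurable_itv.
Qed.

Lemma measurable_cone_box c s : measurable (cone_box c s).
Proof. by apply: measurableX; [exact: measurable_itv|exact: measurable_tuple_box]. Qed.

Lemma cone_box_measure c s : 0 < s ->
  (lebesgue_measure \x lebesgue_tuple R m)%E (cone_box c s) =
  ((expR (c ord0 + s) - expR (c ord0)) * s ^+ m)%:E.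
Proof.
move=> s0; rewrite product_measure1E; last 2 first.
- exact: measurable_itv.
- exact: measurable_tuple_box.
rewrite (lebesgue_tuple_box
  (A := fun j => [set` `[c (lift ord0 j), c (lift ord0 j) + s[])); last first.
  by move=> j; exact: measurable_itv.
rewrite EFinM; congr (_ * _)%E.
  by apply: lebesgue_measure_co; rewrite ltr_expR ltrDl.
under eq_bigr => j _.
  rewrite (_ : lebesgue_measure _ = s%:E); last first.
    by rewrite lebesgue_measure_co ?ltrDl// addrAC subrr add0r.
  over.
by rewrite prodEFin prodr_const card_ord.
Qed.

(** On a cell the density [1 / t] is at least [exp (- (c_0 + s))], and the cell has length
    [exp (c_0 + s) - exp c_0] in [t]. The product of the two is [1 - exp (- s)], which is at least
    [s / 2] for [s <= 1]; hence the factor 2. *)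
Lemma cone_integral_cells (I : finType) (c : I -> 'I_m.+1 -> R) (a : I -> R)
    (s : R) (D : set pt) (g : pt -> R) :
  0 < s <= 1 -> (forall k, 0 <= a k) -> (forall p, D p -> 0 < p.1 /\ 0 <= g p) ->
  (forall k l q, cone_cell (c k) s q -> cone_cell (c l) s q -> k = l) ->
  (forall k q, 0 < a k -> cone_cell (c k) s q -> D q /\ a k <= g q) ->
  ((\sum_k a k * s ^+ m.+1)%:E <= 2%:E * cone_integral D (fun q => (g q)%:E))%E.
Proof.
move=> /andP[s0 s1] a0 Dg cI ag.
pose w k := a k * expR (- (c k ord0 + s)).
have w0 k : 0 <= w k by rewrite mulr_ge0 ?expR_ge0.
have wle k z : cone_box (c k) s z -> 0 < a k -> w k <= g (pt_of z) * (pt_of z).1^-1.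
  rewrite cone_boxE => cz ak; have [Dz az] := ag k _ ak cz.
  have [z0 gz] := Dg _ Dz; apply: ler_pM; [exact: a0|exact: expR_ge0|exact: az|].
  rewrite expRN lef_pV2 ?posrE ?expR_gt0//.
  have := cz.2 ord0 => /andP[_ /ltW]; rewrite /cone_coord unlift_none.
  by rewrite -ler_expR lnK ?posrE.
have := le_integral_step (lebesgue_measure \x lebesgue_tuple R m)%E
  (D := @pt_of R m @^-1` D)
  (f := fun z => ((g (pt_of z))%:E * ((pt_of z).1^-1)%:E)%E) w0
  (fun k => measurable_cone_box (c k) s).
have nn z : (@pt_of R m @^-1` D) z ->
    (0 <= (g (pt_of z))%:E * ((pt_of z).1^-1)%:E)%E.
  move=> Dz; have [z0 gz] := Dg _ Dz.
  by rewrite -EFinM lee_fin mulr_ge0// invr_ge0 ltW.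
move=> /(_ nn) step.
have {}step := step _.
apply: le_trans (lee_wpmul2l _ (step _)); first last.
(* As the cells are disjoint, the step function has at most one nonzero term at [z]. *)
- move=> z; have [[k [cz ak]]|noc] :=
    pselect (exists k, cone_box (c k) s z /\ 0 < a k).
    rewrite (bigD1 k)//= big1 ?addr0 => [|l lk].
      have Dz : (@pt_of R m @^-1` D) z.
        by move: cz; rewrite cone_boxE => cz; have [] := ag k _ ak cz.
      rewrite patchE mem_set// indicE mem_set// mulr1 -EFinM lee_fin.
      exact: wle.
    rewrite indicE memNset ?mulr0// => lz.
    move: cz lz; rewrite !cone_boxE => cz lz.
    by move/eqP: lk; apply; exact: cI lz cz.
  rewrite big1; first exact: erestrict_ge0.
  move=> k _; rewrite indicE; case: (boolP (z \in _)) => [|_]; last by rewrite mulr0.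
  rewrite inE => cz; suff -> : w k = 0 by rewrite mul0r.
  rewrite /w; suff -> : a k = 0 by rewrite mul0r.
  apply/eqP; rewrite eq_le a0 andbT leNgt; apply/negP => ak.
  by apply: noc; exists k.
- by rewrite lee_fin.
rewrite ge0_sume_distrr; last first.
  by move=> k _; rewrite mule_ge0 ?lee_fin.
rewrite -sumEFin; apply: lee_sum => k _.
rewrite [X in (_ <= _ * (_ * X))%E](_ : _ =
  ((expR (c k ord0 + s) - expR (c k ord0)) * s ^+ m)%:E); last first.
  exact: cone_box_measure.
rewrite -!EFinM lee_fin /w exprS.
have es : s / 2 <= 1 - expR (- s).
  have e1 : expR (- s) <= (1 + s)^-1.
    by rewrite expRN lef_pV2 ?posrE ?expR_gt0 ?expR_ge1Dx// addr_gt0.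
  have e2 : (1 + s)^-1 <= 1 - s / 2.
    rewrite -[leLHS]mul1r ler_pdivrMr; last lra.
    by nra.
  by lra.
have -> : a k * expR (- (c k ord0 + s)) *
    ((expR (c k ord0 + s) - expR (c k ord0)) * s ^+ m) =
    a k * s ^+ m * (1 - expR (- s)).
  have -> : expR (c k ord0) = expR (c k ord0 + s) * expR (- s).
    by rewrite -expRD addrK.
  have e1 : expR (c k ord0 + s) * expR (- (c k ord0 + s)) = 1.
    by rewrite -expRD subrr expR0.
  rewrite -[RHS]mulr1 -[X in _ = _ * X]e1; ring.
have : 0 <= a k * s ^+ m by rewrite mulr_ge0// exprn_ge0// ltW.
by move=> as0; nra.
Qed.

End cells.

(** * The potential of [|t^2 f|] *)
Section potential.
Context (R : realType) (m : nat).
Local Notation pt := (R * 'rV[R]_m.+1)%type.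
Implicit Types (p q o : pt) (c : 'I_m.+2 -> R) (e s : R).

(** In dimension [m.+2] the exponent [n - 2] is the natural number [m], so a natural power of the
    regularised distance replaces the real power. *)
Lemma cone_kernelE e c p : 0 < e ->
  cone_kernel e c p = expR (- (m%:R / 2) * (cone_coord ord0 p - c ord0)) *
    Num.sqrt (e + sq_dist c p) ^- m.
Proof.
move=> e0; have Q0 : 0 < e + sq_dist c p by rewrite ltr_wpDr// sq_dist_ge0.
rewrite /cone_kernel; set Q := e + _ in Q0 *.
have r0 : 0 < Num.sqrt Q by rewrite sqrtr_gt0.
have -> : m.+2%:R - 2 = m%:R :> R by rewrite -addn2 natrD addrK.
rewrite mulrDr expRD; congr (_ * _).
have -> : ln Q = ln (Num.sqrt Q) *+ 2.
  by rewrite -{1}(sqr_sqrtr (ltW Q0)) lnXn.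
have -> : - (m%:R / 2) * (ln (Num.sqrt Q) *+ 2) = - (m%:R * ln (Num.sqrt Q)).
  by rewrite -[_ *+ 2]mulr_natr; field.
by rewrite expRN expRM_natl lnK.
Qed.

Definition kernel_mass : R :=
  expR (- (m%:R / 2)) * (m%:R * m.+2%:R) / m.+3%:R ^+ m.+4.

Lemma kernel_mass_gt0 : (0 < m)%N -> 0 < kernel_mass.
Proof.
by move=> m0; rewrite divr_gt0 ?exprn_gt0// mulr_gt0 ?expR_gt0// mulr_gt0// ltr0n.
Qed.

(** On the cell of side [s] at its own corner, [e + |z|^2] with [e = s ^ 2] is at most [(m.+3 s)^2].
    The kernel is thus at least of order [s ^- m] and the source factor of order [s ^- 2]: the
    kernel acts like a mass of at least [kernel_mass] spread over the volume [s ^ m.+2]. *)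
Lemma cone_kernel_cell c s p : 0 < s <= 1 -> cone_cell c s p ->
  kernel_mass <= - (s ^+ m.+2 * (p.1 ^+ 2 * cone_operator (cone_kernel (s ^+ 2) c) p)).
Proof.
move=> /andP[s0 s1] [p0 cp].
have e0 : 0 < s ^+ 2 by rewrite exprn_gt0.
rewrite cone_operator_kernel//.
have -> : m.+2%:R - 2 = m%:R :> R by rewrite -addn2 natrD addrK.
have Q0 : 0 < s ^+ 2 + sq_dist c p by rewrite ltr_wpDr// sq_dist_ge0.
have QA : s ^+ 2 + sq_dist c p <= (m.+3%:R * s) ^+ 2.
  have : sq_dist c p <= m.+2%:R * s ^+ 2.
    rewrite mulr_natl -[m.+2 in leRHS]card_ord -sumr_const.
    apply: ler_sum => i _; have /andP[ci ic] := cp i.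
    rewrite lerXn2r ?nnegrE ?subr_ge0 ?(ltW s0)//.
    by rewrite lerBlDl ltW.
  have m3 : m.+3%:R = m.+2%:R + 1 :> R by rewrite -[m.+3]addn1 natrD.
  have : 0 <= m.+2%:R :> R by [].
  have := sqr_ge0 s; rewrite exprMn m3; nra.
have A0 : 0 < m.+3%:R * s by rewrite mulr_gt0.
have sqA : Num.sqrt (s ^+ 2 + sq_dist c p) <= m.+3%:R * s.
  by rewrite -[leRHS]gtr0_norm// -sqrtr_sqr ler_wsqrtr.
rewrite cone_kernelE//; set Q := _ + sq_dist c p in Q0 QA sqA *.
have r0 : 0 < Num.sqrt Q by rewrite sqrtr_gt0.
have kern : expR (- (m%:R / 2)) * (m.+3%:R * s) ^- m <=
    expR (- (m%:R / 2) * (cone_coord ord0 p - c ord0)) * Num.sqrt Q ^- m.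
  apply: ler_pM; rewrite ?expR_ge0 ?invr_ge0 ?exprn_ge0 ?(ltW A0)//.
    rewrite ler_expR mulNr lerN2 ler_piMr// ?divr_ge0//.
    by have /andP[_ ic] := cp ord0; rewrite lerBlDl (le_trans (ltW ic))// lerD2l.
  rewrite lef_pV2 ?posrE ?exprn_gt0//.
  by rewrite lerXn2r ?nnegrE ?(ltW r0) ?(ltW A0).
have src : m%:R * m.+2%:R * s ^+ 2 / (m.+3%:R * s) ^+ 4 <=
    m%:R ^+ 2 / 4 + m%:R * m.+2%:R * s ^+ 2 / Q ^+ 2.
  apply: (@le_trans _ _ (m%:R * m.+2%:R * s ^+ 2 / Q ^+ 2)).
    apply: ler_wpM2l; first by rewrite mulr_ge0// ltW.
    rewrite lef_pV2 ?posrE ?exprn_gt0//.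
    rewrite (_ : _ ^+ 4 = (m.+3%:R * s) ^+ 2 ^+ 2); last by rewrite -exprM.
    by rewrite lerXn2r ?nnegrE ?exprn_ge0// ltW.
  by rewrite lerDr divr_ge0 ?exprn_ge0.
have src0 : 0 <= m%:R * m.+2%:R * s ^+ 2 / (m.+3%:R * s) ^+ 4.
  by rewrite divr_ge0 ?exprn_ge0 ?(ltW A0)// mulr_ge0// ltW.
have kern0 : 0 <= expR (- (m%:R / 2)) * (m.+3%:R * s) ^- m.
  by rewrite mulr_ge0 ?expR_ge0// invr_ge0 exprn_ge0// ltW.
rewrite mulNr mulrN opprK.
apply: le_trans (ler_wpM2l _ (ler_pM kern0 src0 kern src)); last first.
  by rewrite exprn_ge0// ltW.
rewrite le_eqVlt; apply/orP; left; apply/eqP; rewrite /kernel_mass.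
have sN : s != 0 by rewrite gt_eqF.
have AN : m.+3%:R != 0 :> R by [].
move: (m.+3%:R) (m.+2%:R) (expR _) AN => A B E AN.
rewrite !exprMn -[m.+4]addn4 -[m.+2]addn2 !exprD.
by field; rewrite sN AN !expf_neq0.
Qed.

(** The lower corner of cell [k], in a cube of half-side [s J] centred at [o] with [2 J] cells per
    direction. *)
Definition grid (J : nat) s o (k : {ffun 'I_m.+2 -> 'I_(2 * J)}) (i : 'I_m.+2) : R :=
  cone_coord i o + s * ((k i)%:R - J%:R).

(** The point [o] is at distance at least [s * shell k] from the corner, and the regularisation
    [s ^ 2] supplies the successor in [(shell k).+1], which keeps the bound finite in the central
    shell. *)
Lemma cone_kernel_grid J s o k : 0 < s ->
  cone_kernel (s ^+ 2) (@grid J s o k) o <=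
  expR (m%:R / 2 * (s * J%:R)) * (s * (shell k).+1%:R / 2) ^- m.
Proof.
move=> s0; have e0 : 0 < s ^+ 2 by rewrite exprn_gt0.
have off i : ((offset J (k i))%:R : R) ^+ 2 = ((k i)%:R - J%:R) ^+ 2.
  rewrite /offset; case: (leqP J (k i)) => kJ.
    have /eqP -> : (J - k i == 0)%N by rewrite subn_eq0.
    by rewrite addn0 natrB.
  have /eqP -> : (k i - J == 0)%N by rewrite subn_eq0 ltnW.
  by rewrite add0n natrB ?(ltnW kJ)// -sqrrN opprB.
have dist : s ^+ 2 * (shell k)%:R ^+ 2 <= sq_dist (grid s o k) o.
  have [i _ ->] : {i | i \in 'I_m.+2 & shell k = offset J (k i)}.
    by apply: eq_bigmax_cond; rewrite card_ord.
  rewrite /sq_dist (bigD1 i)//= off /grid opprD addNKr -mulrN -exprMn mulrN sqrrN.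
  by rewrite ?mulrN ?sqrrN lerDl; apply: sumr_ge0 => j _; exact: sqr_ge0.
have Q0 : 0 < s ^+ 2 + sq_dist (grid s o k) o by rewrite ltr_wpDr// sq_dist_ge0.
rewrite cone_kernelE//; apply: ler_pM; rewrite ?expR_ge0 ?invr_ge0 ?exprn_ge0//.
  rewrite ler_expR /grid opprD addNKr mulrNN ler_wpM2l ?divr_ge0//.
  rewrite ler_wpM2l ?(ltW s0)// lerBlDr -natrD ler_nat.
  by rewrite ltnW// addnn -mul2n ltn_ord.
have h0 : 0 < s * (shell k).+1%:R / 2 by rewrite divr_gt0// mulr_gt0.
rewrite lef_pV2 ?posrE ?exprn_gt0 ?sqrtr_gt0//.
rewrite lerXn2r ?nnegrE ?sqrtr_ge0 ?(ltW h0)//.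
rewrite -[leLHS]gtr0_norm// -sqrtr_sqr ler_wsqrtr//.
have s1 : (shell k).+1%:R = (shell k)%:R + 1 :> R by rewrite -addn1 natrD.
have := ler0n R (shell k); rewrite s1; set x := _%:R in dist * => x0.
rewrite expr_div_n exprMn.
have : (x + 1) ^+ 2 <= 4 * (1 + x ^+ 2) by nra.
by move: e0 dist; set y := s ^+ 2; set z := sq_dist _ _; nra.
Qed.

(* Young's inequality for the exponents [m.+2] and its conjugate, with the real
   power of [r] traded for a bound [r <= A]. *)
Lemma young_power (A r x : R) : 0 < r <= A -> 0 <= x ->
  x * r ^- m <= r ^- m.+1 + A * x ^+ m.+2.
Proof.
move=> /andP[r0 rA] x0; have rm0 : 0 < r ^+ m by rewrite exprn_gt0.
have A0 : 0 < A by exact: lt_le_trans rA.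
(* If [x r <= 1] the first term on the right suffices, otherwise the second. *)
have [xr|xr] := leP (x * r) 1.
  apply: le_trans (_ : r ^- m.+1 <= _); last first.
    by rewrite lerDl mulr_ge0 ?exprn_ge0 ?(ltW A0).
  by rewrite exprS invfM ler_wpM2r ?invr_ge0 ?(ltW rm0)// -[_^-1]mul1r ler_pdivlMr.
apply: le_trans (_ : A * x ^+ m.+2 <= _); last first.
  by rewrite lerDr invr_ge0 exprn_ge0 ?(ltW r0).
rewrite ler_pdivrMr// exprS.
rewrite [leRHS](_ : _ = x * (A * (x ^+ m.+1 * r ^+ m))); last by ring.
rewrite -[leLHS]mulr1 ler_wpM2l//.
have /le_trans : 1 <= (x * r) ^+ m.+1 by rewrite exprn_ege1// ltW.
apply; rewrite exprMn [r ^+ m.+1]exprS mulrCA.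
by rewrite ler_wpM2r// mulr_ge0 ?exprn_ge0 ?(ltW r0).
Qed.

End potential.

Lemma second_order_sumZ_operator (R : realType) (m : nat) (I : finType)
    (c : I -> R) (u : I -> R * 'rV[R]_m -> R)
    (d1 d2 : I -> 'I_m.+1 -> R * 'rV[R]_m -> R) p :
  (forall k, second_order (u k) (d1 k) (d2 k)) -> 0 < p.1 ->
  p.1 ^+ 2 * cone_operator (fun q => \sum_k c k * u k q) p =
  \sum_k c k * (p.1 ^+ 2 * cone_operator (u k) p).
Proof.
move=> du p0.
rewrite (second_order_operator (second_order_sum (index_enum I)
  (fun k => second_orderZ (c k) (du k))))// exchange_big mulr_sumr -big_split /=.
apply: eq_bigr => k _; rewrite (second_order_operator (du k))// mulrDr mulr_sumr.
by rewrite mulrCA.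
Qed.

Section potential.
Context (R : realType) (m : nat).
Local Notation pt := (R * 'rV[R]_m.+1)%type.
Implicit Types (p q o : pt) (c : 'I_m.+2 -> R) (e s : R).

Lemma exprD_le2 (x y : R) n : 0 <= x -> 0 <= y ->
  (x + y) ^+ n <= 2 ^+ n * (x ^+ n + y ^+ n).
Proof.
move=> x0 y0; have [xy|yx] := leP x y.
  apply: (@le_trans _ _ ((2 * y) ^+ n)).
    by rewrite lerXn2r ?nnegrE ?addr_ge0 ?mulr_ge0//; lra.
  by rewrite exprMn ler_wpM2l ?exprn_ge0// lerDr exprn_ge0.
apply: (@le_trans _ _ ((2 * x) ^+ n)).
  by rewrite lerXn2r ?nnegrE ?addr_ge0 ?mulr_ge0//; lra.
by rewrite exprMn ler_wpM2l ?exprn_ge0// lerDl exprn_ge0.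
Qed.

Lemma grid_cell_inj J s o p (k l : {ffun 'I_m.+2 -> 'I_(2 * J)}) : 0 < s ->
  cone_cell (grid s o k) s p -> cone_cell (grid s o l) s p -> k = l.
Proof.
move=> s0 [_ kp] [_ lp]; apply/ffunP => i; apply/val_inj/eqP.
have := kp i; have := lp i; rewrite /grid.
move=> /andP[lx xl] /andP[kx xk].
have aux (a' b' : nat) : s * (a'%:R - J%:R) < s * (b'%:R - J%:R) + s -> (a' <= b')%N.
  move=> ab; have : s * a'%:R < s * b'.+1%:R.
    by rewrite -natr1 mulrDr mulr1; move: ab; rewrite !mulrBr; lra.
  by rewrite ltr_pM2l// ltr_nat ltnS.
rewrite eqn_leq; apply/andP; split; apply: aux;
  rewrite -(ltrD2l (cone_coord i o)) addrA.
  exact: le_lt_trans kx xl.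
exact: le_lt_trans lx xk.
Qed.

Lemma grid_cell_ex J s o p : 0 < s -> (0 < p.1) ->
  (forall i, `|cone_coord i p - cone_coord i o| < s * J%:R) ->
  exists k : {ffun 'I_m.+2 -> 'I_(2 * J)}, cone_cell (grid s o k) s p.
Proof.
move=> s0 p0 po.
(* The coordinate in units of [s], counted from the lower corner of the cube; its integer part is
   the index. *)
pose a i := (cone_coord i p - cone_coord i o) / s + J%:R.
have pE i : cone_coord i p = cone_coord i o + s * (a i - J%:R).
  by rewrite /a addrK mulrC divfK ?gt_eqF// addrC subrK.
have ab i : 0 <= a i < (2 * J)%:R.
  have := po i; rewrite ltr_norml => /andP[l u].
  rewrite /a -lerBlDr sub0r ler_pdivlMr// mulNr mulrC (ltW l)/=.
  by rewrite -ltrBrDr ltr_pdivrMr// mul2n -addnn natrD addrK mulrC.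
have kb i : (Num.truncn (a i) < 2 * J)%N.
  by have /andP[a0 aJ] := ab i; rewrite -(ltr_nat R) (le_lt_trans _ aJ)// truncn_le.
exists [ffun i => Ordinal (kb i)]; split=> // i; rewrite /grid ffunE /= pE.
have /andP[a0 _] := ab i; have /andP[ta at1] := truncn_itv a0.
have : s * a i < s * (Num.truncn (a i)).+1%:R by rewrite ltr_pM2l.
have : s * (Num.truncn (a i))%:R <= s * a i by rewrite ler_pM2l.
move: (a i) (Num.truncn (a i)) => x t.
by rewrite -natr1 [s * (_ + 1)]mulrDr mulr1 !mulrBr => ? ?; apply/andP; split; lra.
Qed.

Lemma grid_cell_close J s o (k : {ffun 'I_m.+2 -> 'I_(2 * J)}) p q i :
  cone_cell (grid s o k) s p -> cone_cell (grid s o k) s q ->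
  `|cone_coord i p - cone_coord i q| <= s.
Proof.
move=> [_ /(_ i) /andP[p1 p2]] [_ /(_ i) /andP[q1 q2]]; rewrite ler_norml.
by move: p1 p2 q1 q2; lra.
Qed.

(** [phi] is a discrete potential: one kernel per cell that meets [K], weighted by the size of [F]
    there. Every kernel is a supersolution, and the one whose cell contains [p] alone accounts for
    [- |F p|]. Uniform continuity at [K] makes the sampled values comparable with those on the whole
    cell, hence the sum of their powers with the integral. [C] precedes the data, as it depends only
    on [m] and [rho]. *)
Lemma cone_potential_ex (rho : R) : (0 < m)%N -> 0 < rho ->
  exists2 C : R, 0 < C &
  forall (D K : set pt) (F : pt -> R) o (N : R), 0 < N ->
    (forall p, D p -> 0 < p.1) -> (forall p, K p -> 0 < p.1) ->
    (cone_integral D (fun p => (`|F p| ^+ m.+2)%:E) <= (N ^+ m.+2)%:E)%E ->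
    (forall e, 0 < e -> exists2 d, 0 < d & forall p q, K p -> 0 < q.1 ->
       (forall i, `|cone_coord i p - cone_coord i q| <= d) ->
       D q /\ `|F q - F p| <= e) ->
  exists phi d1 d2, [/\ second_order phi d1 d2,
    forall p, 0 < p.1 -> 0 <= phi p,
    forall p, 0 < p.1 -> p.1 ^+ 2 * cone_operator phi p <= 0,
    forall p, K p -> (forall i, `|cone_coord i p - cone_coord i o| < rho) ->
       p.1 ^+ 2 * cone_operator phi p <= - `|F p| &
    phi o <= C * N].
Proof.
move=> m0 rho0; pose E : R := expR (m%:R / 2 * rho).
pose C2 : R := (m.+2 * 2 ^ m.+2 * 2)%N%:R.
pose C3 : R := 2 ^+ m.+2 * 3.
have M0 := @kernel_mass_gt0 R m m0.
pose C := (kernel_mass R m)^-1 * E * 2 ^+ m * (C2 * rho + (rho + 1) * C3).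
have C20 : 0 < C2 by rewrite ltr0n 2!muln_gt0 expn_gt0.
have C30 : 0 < C3 by rewrite mulr_gt0// exprn_gt0.
exists C.
  rewrite mulr_gt0//; last by rewrite addr_gt0// mulr_gt0// addr_gt0.
  by rewrite mulr_gt0 ?exprn_gt0// mulr_gt0 ?invr_gt0 ?expR_gt0.
move=> D K F o N N0 Dpos Kpos FN unif.
(* Chosen so that [2 e * 2 J * s = N]: an error of [2 e] on each of the [(2 J) ^ m.+2] cells then
   adds up to [N ^ m.+2] in the sum of powers. *)
have e0 : 0 < N / (4 * rho) by rewrite divr_gt0// mulr_gt0.
set e := N / (4 * rho) in e0.
have eE : 4 * rho * e = N by rewrite /e mulrC divfK// mulf_neq0// gt_eqF.
clearbody e; have [d d0 dP] := unif e e0.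
pose J := (Num.truncn (rho / Num.min 1 d)).+1.
have J0 : 0 < J%:R :> R by [].
pose s := rho / J%:R.
have s0 : 0 < s by rewrite divr_gt0.
have sJ : s * J%:R = rho by rewrite divfK ?gt_eqF.
have smin : s <= Num.min 1 d.
  have mn : 0 < Num.min 1 d by rewrite lt_min ltr01.
  rewrite ler_pdivrMr// mulrC -ler_pdivrMr//; apply/ltW.
  have r0 : 0 <= rho / Num.min 1 d by rewrite divr_ge0 ?ltW.
  by have /andP[] := truncn_itv r0.
have /andP[s1 sd] : (s <= 1) && (s <= d) by rewrite -le_min.
clearbody s.
pose cell (k : {ffun 'I_m.+2 -> 'I_(2 * J)}) := cone_cell (grid s o k) s.
(* A sample point of [K] in the cell; the default [o] occurs only for cells that miss [K], where the
   weight [a k] is 0. *)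
pose rep k : pt := xget o (K `&` cell k).
pose a k : R := if pselect (exists p, (K `&` cell k) p) then `|F (rep k)| + e else 0.
have a0 k : 0 <= a k.
  by rewrite /a; case: pselect => //= ?; rewrite addr_ge0// ltW.
have repP k : 0 < a k -> K (rep k) /\ cell k (rep k).
  rewrite /a; case: pselect => [[p Kp] /= _|?]; last by rewrite /= ltxx.
  by have := @xgetPex _ o (K `&` cell k) (ex_intro _ p Kp).
have aE k : 0 < a k -> a k = `|F (rep k)| + e.
  by rewrite /a; case: pselect => //= ?; rewrite ltxx.
have aF k q : 0 < a k -> cell k q -> D q /\ `|F q - F (rep k)| <= e.
  move=> ak kq; have [Kr kr] := repP k ak; apply: dP => //; first by case: kq.
  by move=> i; apply: le_trans sd; exact: grid_cell_close kr kq.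
have Fa k p : K p -> cell k p -> `|F p| <= a k.
  move=> Kp kp; have ak : 0 < a k.
    rewrite /a; case: pselect => [?|nK] /=; first by rewrite ltr_wpDl.
    by case: nK; exists p.
  have [_ Fpr] := aF k p ak kp; rewrite aE//.
  rewrite -[F p](subrK (F (rep k))) addrC.
  by apply: le_trans (ler_normD _ _) _; rewrite lerD2l.
(* [a] bounds [|F|] from above on the part of [K] in the cell, [w] bounds it from below on the whole
   cell, and they differ by at most [2 e]. *)
pose w k := Num.max 0 (a k - 2 * e).
have w0 k : 0 <= w k by rewrite le_max lexx.
have wF k q : 0 < w k -> cell k q -> D q /\ w k <= `|F q|.
  rewrite lt_max ltxx /= => wk kq; have ak : 0 < a k by lra.
  have [Dq Fqr] := aF k q ak kq; split => //.
  rewrite /w max_r ?(ltW wk)// aE//.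
  have := ler_normD (F (rep k) - F q) (F q); rewrite subrK distrC; lra.
have aw k : a k <= w k + 2 * e by rewrite -lerBlDr /w le_max lexx orbT.
have sumw : \sum_k w k ^+ m.+2 * s ^+ m.+2 <= 2 * N ^+ m.+2.
  rewrite -lee_fin.
  apply: le_trans (@cone_integral_cells R m.+1 _ (fun k => grid s o k)
    (fun k => w k ^+ m.+2) s D (fun p => `|F p| ^+ m.+2) _ _ _ _ _) _.
  - by rewrite s0.
  - by move=> k; rewrite exprn_ge0.
  - by move=> p Dp; rewrite exprn_ge0//; split => //; exact: Dpos.
  - by move=> k l q; exact: grid_cell_inj.
  - move=> k q wk0 kq; have wk : 0 < w k.
      rewrite lt_neqAle w0 andbT eq_sym; apply: contraTneq wk0 => ->.
      by rewrite expr0n ltxx.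
    by have [Dq wq] := wF k q wk kq; split; rewrite ?lerXn2r ?nnegrE.
  - by rewrite EFinM lee_wpmul2l ?lee_fin.
(* By [a <= w + 2 e]: the part with [w] is at most [2 N ^ m.+2] and the error part is [N ^ m.+2],
   whence the 3 in [C3]. *)
have suma : \sum_k s ^+ m.+2 * (a k / N) ^+ m.+2 <= C3.
  have Nn : 0 < N ^+ m.+2 by rewrite exprn_gt0.
  apply: (@le_trans _ _ (\sum_k (2 ^+ m.+2 / N ^+ m.+2) *
      (w k ^+ m.+2 * s ^+ m.+2 + s ^+ m.+2 * (2 * e) ^+ m.+2))).
    apply: ler_sum => k _; rewrite expr_div_n.
    have e20 : 0 <= 2 * e by rewrite mulr_ge0 ?(ltW e0).
    have : a k ^+ m.+2 <= 2 ^+ m.+2 * (w k ^+ m.+2 + (2 * e) ^+ m.+2).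
      apply: le_trans (exprD_le2 _ (w0 k) e20).
      by rewrite lerXn2r ?nnegrE ?addr_ge0.
    have : 0 <= s ^+ m.+2 / N ^+ m.+2 by rewrite divr_ge0 ?exprn_ge0 ?(ltW s0) ?(ltW N0).
    move: (N ^+ m.+2)^-1 (a k ^+ m.+2) (s ^+ m.+2) (2 ^+ m.+2 : R) => Ni ak sk tk sN.
    move=> /(ler_wpM2l sN) H; apply: le_trans (le_trans H _);
      by rewrite le_eqVlt; apply/orP; left; apply/eqP; ring.
  rewrite -mulr_sumr big_split /= sumr_const card_ffun !card_ord.
  have -> : s ^+ m.+2 * (2 * e) ^+ m.+2 *+ (2 * J) ^ m.+2 = N ^+ m.+2.
    rewrite -[_ *+ _]mulr_natr natrX -!exprMn; congr (_ ^+ _).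
    rewrite natrM [LHS](_ : _ = 4 * (s * J%:R) * e); last by ring.
    by rewrite sJ.
  rewrite /C3 -mulrA ler_wpM2l ?exprn_ge0// mulrC ler_pdivrMr//.
  by move: sumw; lra.
have sC := second_order_sum (index_enum {ffun 'I_m.+2 -> 'I_(2 * J)})
  (fun k => second_orderZ ((kernel_mass R m)^-1 * (a k * s ^+ m.+2))
  (second_order_kernel (grid s o k) (exprn_gt0 2 s0))).
(* With this weight the kernel of cell [k] contributes at most [- a k] on that cell. *)
pose c k := (kernel_mass R m)^-1 * (a k * s ^+ m.+2).
have c0 k : 0 <= c k.
  by rewrite /c mulr_ge0 ?invr_ge0 ?(ltW M0)// mulr_ge0// exprn_ge0// ltW.
have LE p (p0 : 0 < p.1) := second_order_sumZ_operator c
  (fun k => second_order_kernel (grid s o k) (exprn_gt0 2 s0)) p0.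
have L0 k p : 0 < p.1 ->
    p.1 ^+ 2 * cone_operator (cone_kernel (s ^+ 2) (@grid R m J s o k)) p <= 0.
  move=> p0; rewrite cone_operator_kernel ?exprn_gt0//.
  rewrite mulNr oppr_le0 mulr_ge0 ?expR_ge0//.
  have -> : m.+2%:R - 2 = m%:R :> R by rewrite -addn2 natrD addrK.
  have s20 : 0 <= s ^+ 2 by rewrite exprn_ge0// ltW.
  apply: addr_ge0; first by rewrite divr_ge0// exprn_ge0.
  apply: divr_ge0; first by rewrite mulr_ge0// mulr_ge0.
  by rewrite exprn_ge0// addr_ge0// sq_dist_ge0.
eexists; eexists; eexists; split; first exact: sC.
- move=> p p0; apply: sumr_ge0 => k _.
  by apply: mulr_ge0 (c0 k) _; exact: expR_ge0.
- by move=> p p0; rewrite LE//; apply: sumr_le0 => k _; rewrite mulr_ge0_le0// L0.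
- move=> p Kp po; have p0 := Kpos p Kp.
  have [|k kp] := @grid_cell_ex J s o p s0 p0; first by rewrite sJ.
  rewrite LE// (bigD1 k)//=; apply: (@le_trans _ _ (- a k)); last first.
    by rewrite lerN2 Fa.
  rewrite -[leRHS]addr0; apply: lerD; last first.
    by apply: sumr_le0 => l _; rewrite mulr_ge0_le0// L0.
  have := cone_kernel_cell _ kp; rewrite s0 s1 => /(_ isT).
  move: (p.1 ^+ 2 * _) => x; rewrite -mulrN => Mx.
  rewrite /c [leLHS](_ : _ = - (a k * ((kernel_mass R m)^-1 * (s ^+ m.+2 * - x))));
    last by ring.
  rewrite lerN2 -[leLHS]mulr1 ler_wpM2l// mulrC ler_pdivlMr// mul1r.
  exact: Mx.
have r1 k : 0 < s * (@shell m.+2 J k).+1%:R <= rho + 1.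
  rewrite mulr_gt0//= -sJ -natr1 mulrDr mulr1 lerD// ler_pM2l// ler_nat.
  exact: shell_le.
have B0 : 0 <= (kernel_mass R m)^-1 * E * 2 ^+ m * N.
  rewrite mulr_ge0 ?(ltW N0)// mulr_ge0 ?exprn_ge0//.
  by rewrite mulr_ge0 ?expR_ge0// invr_ge0 ltW.
(* Young's inequality with [x = a k / N] and [r = s * (shell k).+1]. The first terms are summed by
   [sum_shell], the second by [suma]; dividing by [N] makes the bound linear in [N]. *)
have term k : c k * cone_kernel (s ^+ 2) (grid s o k) o <=
    ((kernel_mass R m)^-1 * E * 2 ^+ m * N) *
    (s * (shell k).+1%:R ^- m.+1 + (rho + 1) * (s ^+ m.+2 * (a k / N) ^+ m.+2)).
  apply: le_trans (ler_wpM2l (c0 k) (cone_kernel_grid o k s0)) _.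
  rewrite sJ -/E expr_div_n invfM invrK.
  have := young_power m (r1 k) (divr_ge0 (a0 k) (ltW N0)).
  have -> : s * (shell k).+1%:R ^- m.+1 =
      s ^+ m.+2 * (s * (shell k).+1%:R) ^- m.+1.
    rewrite exprMn invfM mulrA [s ^+ m.+2]exprS -mulrA mulrA mulfK//.
    by rewrite expf_neq0// gt_eqF.
  have NE : a k / N * N = a k by rewrite divfK// gt_eqF.
  rewrite /c -[in a k * _]NE; move: (a k / N) (s * _) => x r yp.
  have sn0 : 0 <= (kernel_mass R m)^-1 * E * 2 ^+ m * N * s ^+ m.+2.
    by rewrite mulr_ge0 ?exprn_ge0 ?(ltW s0).
  have := ler_wpM2l sn0 yp.
  move: (r ^+ m)^-1 (r ^+ m.+1)^-1 (x ^+ m.+2) (s ^+ m.+2) => r' r'' x' s' H.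
  by apply: le_trans (le_trans H _);
    rewrite le_eqVlt; apply/orP; left; apply/eqP; ring.
apply: le_trans (ler_sum _ (fun k _ => term k)) _.
rewrite -mulr_sumr big_split /= -mulr_sumr -[X in _ + X]mulr_sumr.
rewrite /C [leRHS](_ : _ = ((kernel_mass R m)^-1 * E * 2 ^+ m * N) *
  (C2 * rho + (rho + 1) * C3)); last by ring.
apply: ler_wpM2l => //.
apply: lerD; last by apply: ler_wpM2l suma; rewrite addr_ge0 ?(ltW rho0).
rewrite -sJ mulrCA ler_pM2l//.
by apply: sum_shell; rewrite /J.
Qed.

End potential.

(** * Convex geometry *)
Section geometry.
Context (R : realType) (m : nat).
Local Notation pt := (R * 'rV[R]_m)%type.
Implicit Types (X : set 'rV[R]_m) (x y z : 'rV[R]_m) (p q : pt).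

Definition row_sq_dist x y : R := \sum_j (x 0 j - y 0 j) ^+ 2.

Definition row_dot x y : R := \sum_j x 0 j * y 0 j.

Lemma row_sq_distE x y : row_sq_dist x y = row_dot (x - y) (x - y).
Proof. by apply: eq_bigr => j _; rewrite !mxE expr2. Qed.

Lemma row_dotDl x y z : row_dot (x + y) z = row_dot x z + row_dot y z.
Proof. by rewrite /row_dot -big_split; apply: eq_bigr => j _; rewrite !mxE mulrDl. Qed.

Lemma row_dotZl (a : R) x y : row_dot (a *: x) y = a * row_dot x y.
Proof. by rewrite /row_dot mulr_sumr; apply: eq_bigr => j _; rewrite !mxE mulrA. Qed.

Lemma row_dotC x y : row_dot x y = row_dot y x.
Proof. by apply: eq_bigr => j _; rewrite mulrC. Qed.

Lemma row_dotBl x y z : row_dot (x - y) z = row_dot x z - row_dot y z.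
Proof. by rewrite row_dotDl -scaleN1r row_dotZl mulN1r. Qed.

Lemma row_sq_dist_ge0 x y : 0 <= row_sq_dist x y.
Proof. by apply: sumr_ge0 => j _; exact: sqr_ge0. Qed.

Lemma row_sq_dist_gt0 x y : x != y -> 0 < row_sq_dist x y.
Proof.
move=> xy; rewrite lt_neqAle row_sq_dist_ge0 andbT eq_sym; apply: contra xy.
rewrite psumr_eq0 => [/allP xy0|j _]; last exact: sqr_ge0.
apply/eqP/matrixP => i j; rewrite ord1.
have := xy0 j (mem_index_enum _); rewrite sqrf_eq0 subr_eq0; exact/eqP.
Qed.

Lemma convex_comb X x y (t : R) : convex_set X -> X x -> X y -> 0 <= t <= 1 ->
  X (t *: x + (1 - t) *: y).
Proof.
move=> cX Xx Xy /andP[t0 t1].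
by have := cX x y (Itv01 t0 t1); rewrite !inE; apply.
Qed.

(* The ball around [x] through [y] lies in [X]; if [z] were on the wrong side
   of the tangent hyperplane at [y], then [y] would lie on a segment from [z]
   to a point of this ball. *)
Lemma convex_nearest X x y z : convex_set X -> open X -> X x -> ~ X y ->
  (forall w, ~ X w -> row_sq_dist x y <= row_sq_dist x w) ->
  X z -> 0 < row_dot (x - y) (z - y).
Proof.
move=> cX oX Xx nXy near Xz.
have xy0 : 0 < row_sq_dist x y.
  by apply: row_sq_dist_gt0; apply/eqP => xy; apply: nXy; rewrite -xy.
have strict w : X w -> row_dot (x - y) (w - y) < 0 -> False.
  move=> Xw I0; pose D := row_sq_dist w y.
  have D0 : 0 < D.
    apply: row_sq_dist_gt0; apply/eqP => wy; apply: nXy; by rewrite -wy.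
  pose I := row_dot (x - y) (w - y); pose e := - I / D.
  have e0 : 0 < e by rewrite divr_gt0// oppr_gt0.
  (* [u] is the foot of the perpendicular from [x] to the line through [w] and [y]. It is closer to
     [x] than [y] is, so it lies in [X], and [y] lies between [u] and [w]. *)
  pose u := y - e *: (w - y).
  have xu : row_sq_dist x u = row_sq_dist x y - I ^+ 2 / D.
    have -> : row_sq_dist x u = row_sq_dist x y + 2 * e * I + e ^+ 2 * D.
      rewrite /D /I /row_sq_dist /row_dot !mulr_sumr -!big_split /=.
      by apply: eq_bigr => j _; rewrite !mxE; ring.
    by rewrite /e; field; rewrite gt_eqF.
  have Xu : X u.
    apply: contrapT => nXu; have := near u nXu; rewrite xu leNgt => /negP; apply.
    rewrite gtrBl divr_gt0// exprn_even_gt0//= lt_eqF//.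
  apply: nXy.
  have e1 : 0 < 1 + e by rewrite addr_gt0.
  have -> : y = (1 + e)^-1 *: u + (1 - (1 + e)^-1) *: w.
    apply/rowP => j; rewrite !mxE; by field; rewrite gt_eqF.
  apply: convex_comb => //.
  by rewrite invr_ge0 (ltW e1)/= invf_le1// lerDl ltW.
rewrite ltNge; apply/negP => I0.
(* The case of equality reduces to the strict one by moving [z] slightly within the open set [X]. *)
have : \forall t \near 0^'+, X (z - t *: (x - y)).
  have ct : (fun t : R => z - t *: (x - y)) @ 0^'+ --> z.
    suff : (fun t : R => z - t *: (x - y)) @ 0^'+ --> z - 0 *: (x - y).
      by rewrite scale0r subr0.
    apply: cvg_at_right_filter; apply: cvgB; first exact: cvg_cst.
    by apply: cvgZl; exact: cvg_id.
  by apply: ct; exact: open_nbhs_nbhs.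
move=> Xt; have [t [t0 Xzt]] : exists t : R, 0 < t /\ X (z - t *: (x - y)).
  have [t [Xzt t0]] := filter_ex (filterI Xt (nbhs_right_gt 0)).
  by exists t.
apply: strict Xzt _.
have -> : z - t *: (x - y) - y = (z - y) - t *: (x - y) by rewrite addrAC.
rewrite row_dotC row_dotBl row_dotZl -row_sq_distE (row_dotC (z - y)).
by rewrite subr_lt0 (le_lt_trans I0)// mulr_gt0.
Qed.

Lemma chart_nbhs p (U : set pt) : 0 < p.1 -> nbhs p U ->
  exists2 r : R, 0 < r & forall q, 0 < q.1 ->
    (forall j, `|cone_coord j q - cone_coord j p| < r) -> U q.
Proof.
move=> p0 /nbhs_ballP[e /= e0 eU].
have /cvgrPdist_lt/(_ e e0) ce := @continuous_expR R (ln p.1).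
have [d /= d0 dE] := ce.
exists (Num.min d e) => [|q q0 qp]; first by rewrite lt_min d0.
apply: eU; split => /=.
  have := qp ord0; rewrite /cone_coord unlift_none lt_min => /andP[qd _].
  have := dE (ln q.1); rewrite /= distrC !lnK ?posrE//; exact.
split=> // i j; rewrite ord1.
have := qp (lift ord0 j); rewrite /cone_coord liftK lt_min distrC => /andP[_].
exact.
Qed.

(** The point [(exp (- 2 d0), x)] is at distance at least [2 d0] from the top [t = 1]. Condition [G]
    gives a boundary point nearer than that, which thus lies on the lateral boundary, outside the
    open set [X]. *)
Lemma condition_G_dist X (K0 sigma d0 : R) : 0 < d0 -> open X ->
  condition_G X K0 sigma d0 -> forall x, X x ->
  exists2 y, ~ X y & row_sq_dist x y < (2 * d0) ^+ 2.
Proof.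
move=> d00 oX GX x Xx.
pose p : pt := (expR (- (2 * d0)), x).
have cylp : cylinder X p.
  split => //=; rewrite expR_gt0/= expR_lt1 oppr_lt0 mulr_gt0//.
have [dp _] := GX p cylp.
have S0 : [set cone_dist p q | q in cylinder_boundary X] !=set0.
  by exists (cone_dist p (1, x)); exists (1, x) => //; left.
have dp2 : dist_boundary X p < 2 * d0 by apply: le_lt_trans dp _; lra.
have [_ [q bq <-] pq] := inf_lt S0 dp2.
have dist2 : (ln p.1 - ln q.1) ^+ 2 + row_sq_dist p.2 q.2 < (2 * d0) ^+ 2.
  rewrite -(sqr_sqrtr (addr_ge0 (sqr_ge0 _) (row_sq_dist_ge0 _ _))).
  by rewrite ltrXn2r ?nnegrE ?sqrtr_ge0// mulr_ge0// ltW.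
case: bq => [[q1 _]|[_ [_ nX]]].
  move: dist2; rewrite q1 ln1 subr0 /= expRK sqrrN.
  by have := row_sq_dist_ge0 x q.2; lra.
exists q.2; first by move=> Xq; apply: nX; rewrite ((interior_id X).1 oX).
by apply: le_lt_trans dist2; rewrite lerDr sqr_ge0.
Qed.

End geometry.

(** * Compactness *)
Section compactness.
Context (R : realType) (m : nat).
Local Notation pt := (R * 'rV[R]_m)%type.
Implicit Types (X : set 'rV[R]_m) (x y z : 'rV[R]_m) (p q : pt).

Definition row_box (b : R) : set 'rV[R]_m :=
  [set y | forall i, y ord0 i \in `[- b, b]].

Lemma compact_row_box b : compact (row_box b).
Proof.
apply: (@rV_compact _ _ (fun=> `[- b, b]%classic)) => _; exact: segment_compact.
Qed.

Lemma coord_le_norm y i : `|y ord0 i| <= `|y|.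
Proof.
rewrite [leRHS]/Num.norm /= mx_normrE; apply/bigmax_geP; right => /=.
by exists (ord0, i).
Qed.

Lemma closure_bounded_box X : bounded_set X ->
  exists2 b : R, 0 <= b & closure X `<=` row_box b.
Proof.
move=> [M [Mreal XM]]; pose b := Num.max 0 (M + 1).
exists b; first by rewrite le_max lexx.
have cb : closed (row_box b).
  by apply: compact_closed; [exact: norm_hausdorff|exact: compact_row_box].
have Xb : X `<=` row_box b.
  move=> y Xy i; rewrite in_itv /= -ler_norml (le_trans (coord_le_norm y i))//.
  apply: le_trans (_ : M + 1 <= b); last by rewrite le_max lexx orbT.
  by apply: XM Xy; rewrite ltrDl.
by rewrite ((closure_id _).1 cb); exact: closureS.
Qed.

Lemma compact_closure X : bounded_set X -> compact (closure X).
Proof.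
move=> /closure_bounded_box[b _ Xb].
apply: (@subclosed_compact _ _ (row_box b)) => //.
  exact: closed_closure.
exact: compact_row_box.
Qed.

Lemma cylinder_closureP X (t0 : R) p : open X -> 0 < t0 -> t0 <= p.1 <= 1 ->
  closure X p.2 -> cylinder_closure X p.
Proof.
move=> oX t00 /andP[tp p1] Xp; have p0 : 0 < p.1 by exact: lt_le_trans tp.
have [Xp2|nX] := pselect (X p.2).
  move: p1; rewrite le_eqVlt => /orP[/eqP p1|p1]; first by right; left.
  by left; split => //; rewrite p0.
right; right; rewrite p0 p1; split => //; split => //.
by rewrite ((interior_id X).1 oX).
Qed.

Lemma open_cylinder X : open X -> open (cylinder X).
Proof.
move=> oX.
rewrite (_ : cylinder X = (fst @^-1` [set t : R | 0 < t]) `&`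
   (fst @^-1` [set t : R | t < 1]) `&` (snd @^-1` X)); last first.
  apply/seteqP; split => p /=; first by move=> [/andP[p0 p1] Xp].
  by move=> [[p0 p1] Xp]; split => //; rewrite p0.
apply: openI; first apply: openI.
- by apply: open_comp => [p _|]; [exact: cvg_fst|exact: open_gt].
- by apply: open_comp => [p _|]; [exact: cvg_fst|exact: open_lt].
- by apply: open_comp => [p _|//]; exact: cvg_snd.
Qed.

Lemma continuous_row_sq_dist (V : topologicalType) (u v : V -> 'rV[R]_m) :
  continuous u -> continuous v -> continuous (fun a : V => row_sq_dist (u a) (v a)).
Proof.
move=> cu cv; rewrite /row_sq_dist.
elim: (index_enum _) => [|j r IHr] a.
  by under eq_fun do rewrite big_nil; exact: cvg_cst.
under eq_fun do rewrite big_cons.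
apply: cvgD; last exact: IHr.
have cj (w : V -> 'rV[R]_m) : continuous w ->
    (fun a : V => w a 0 j) @ a --> w a 0 j.
  move=> cw; apply: (@continuous_comp _ _ _ w (fun x : 'rV[R]_m => x 0 j)).
    exact: cw.
  exact: coord_continuous.
by apply: cvgM; apply: cvgB; exact: cj.
Qed.

(** Maximising over pairs [(p, y)] stands in for the distance to the complement: since [G] increases
    on [[0, A]], the largest value of [- c G (|x - y|)] selects the nearest [y]. The bound by [A]
    also keeps the set compact. *)
Definition outer_pairs X (t0 A : R) : set (pt * 'rV[R]_m) :=
  [set z | [/\ t0 <= z.1.1 <= 1, closure X z.1.2, ~ X z.2 &
               row_sq_dist z.1.2 z.2 <= A ^+ 2]].

Lemma compact_outer_pairs X t0 A : bounded_set X -> open X -> 0 <= A ->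
  compact (outer_pairs X t0 A).
Proof.
move=> bX oX A0; have [b b0 Xb] := closure_bounded_box bX.
have c1 : continuous (fun z : pt * 'rV[R]_m => z.1.1).
  by move=> z; apply: continuous_comp; exact: cvg_fst.
have c2 : continuous (fun z : pt * 'rV[R]_m => z.1.2).
  by move=> z; apply: continuous_comp; [exact: cvg_fst|exact: cvg_snd].
have c3 : continuous (fun z : pt * 'rV[R]_m => z.2).
  by move=> z; exact: cvg_snd.
have cd := continuous_row_sq_dist c2 c3.
apply: (@subclosed_compact _ _
  ((`[t0, 1]%classic `*` closure X) `*` row_box (b + A))).
- rewrite (_ : outer_pairs X t0 A =
    (fun z : pt * 'rV[R]_m => z.1.1) @^-1` [set t | t0 <= t] `&`
    (fun z : pt * 'rV[R]_m => z.1.1) @^-1` [set t | t <= 1] `&`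
    (fun z : pt * 'rV[R]_m => z.1.2) @^-1` closure X `&`
    (fun z : pt * 'rV[R]_m => z.2) @^-1` (~` X) `&`
    (fun z : pt * 'rV[R]_m => row_sq_dist z.1.2 z.2) @^-1` [set d | d <= A ^+ 2]).
    repeat apply: closedI.
    + by apply: (continuous_closedP _).1; [exact: c1|exact: closed_ge].
    + by apply: (continuous_closedP _).1; [exact: c1|exact: closed_le].
    + by apply: (continuous_closedP _).1; [exact: c2|exact: closed_closure].
    + by apply: (continuous_closedP _).1; [exact: c3|exact: open_closedC].
    + by apply: (continuous_closedP _).1; [exact: cd|exact: closed_le].
  apply/seteqP; split => z /=.
    by move=> [/andP[-> ->]].
  by move=> [[[[t1 t2] ?] ?] ?]; split => //; rewrite t1.
- apply: compact_setX; last exact: compact_row_box.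
  by apply: compact_setX; [exact: segment_compact|exact: compact_closure].
- move=> [[t x] y] [/= t1 Xx _ xyA]; split; first by split => //=; rewrite in_itv.
  move=> i; rewrite in_itv /= -ler_norml.
  have := Xb x Xx i; rewrite in_itv /= -ler_norml => xb.
  rewrite -[y _ _](subKr (x ord0 i)); apply: le_trans (ler_normB _ _) _.
  apply: lerD => //; rewrite -(ler_pXn2r (n := 2))// ?nnegrE// real_normK ?num_real//.
  apply: le_trans xyA; rewrite /row_sq_dist (bigD1 i)//= lerDl.
  by apply: sumr_ge0 => j _; exact: sqr_ge0.
Qed.

(** [F] is continuous only inside the cylinder, but the points with [v >= S] stay away from the
    boundary, where [v < S]. Compactness of [[t0, 1]] times the closure of [X] yields a single
    [d]. *)
Lemma uniform_inside X (F v : pt -> R) (t0 S : R) : bounded_set X -> open X ->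
  0 < t0 -> {within cylinder_closure X, continuous v} ->
  continuous_in (cylinder X) F ->
  (forall p, cylinder_boundary X p -> v p < S) ->
  forall e, 0 < e -> exists2 d, 0 < d & forall p q,
    cylinder X p /\ t0 <= p.1 /\ S <= v p -> 0 < q.1 ->
    (forall i, `|cone_coord i p - cone_coord i q| <= d) ->
    cylinder X q /\ `|F q - F p| <= e.
Proof.
move=> bX oX t00 cv cF vS e e0.
have cK : compact (`[t0, 1]%classic `*` closure X).
  by apply: compact_setX; [exact: segment_compact|exact: compact_closure].
move/compact_near_coveringP/near_covering_withinP : cK => cK.
pose P (d : R) p := S <= v p -> forall q, 0 < q.1 ->
  (forall i, `|cone_coord i p - cone_coord i q| <= d) ->
  cylinder X q /\ `|F q - F p| <= e.
have : \forall d \near 0^'+, (`[t0, 1]%classic `*` closure X) `<=` P d.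
  apply: cK => p [/= tp1 Xp]; rewrite in_itv /= in tp1.
  have Cp : cylinder_closure X p by exact: cylinder_closureP t00 tp1 Xp.
  (* Near a point with [v p < S] the property [P] holds vacuously for all [d]. *)
  have [vp|Sv] := ltP (v p) S.
    have := (subspace_continuousP _ _).1 cv p Cp.
    move=> /cvgr_lt/(_ S vp) near_v.
    exists ([set q | cylinder_closure X q -> v q < S], setT).
      by split; [exact: near_v|exact: filterT].
    move=> [q d] [/= qv _] [/= qt Xq]; rewrite in_itv /= in qt.
    have Cq : cylinder_closure X q by exact: cylinder_closureP t00 qt Xq.
    by rewrite /P /= leNgt qv.
  have cylp : cylinder X p by case: Cp => // /vS; rewrite ltNge Sv.
  have p0 : 0 < p.1 by case: cylp => /andP[].
  have e2 : 0 < e / 2 by rewrite divr_gt0.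
  pose U : set pt := [set q | cylinder X q /\ `|F p - F q| < e / 2].
  have nU : nbhs p U.
    apply: filterI; first exact: open_nbhs_nbhs (conj (open_cylinder oX) cylp).
    by have /cvgrPdist_lt/(_ _ e2) := cF p cylp.
  have [r r0 rU] := chart_nbhs p0 nU.
  have r2 : 0 < r / 2 by rewrite divr_gt0.
  pose W : set pt := [set q | forall i, `|cone_coord i q - cone_coord i p| < r / 2].
  exists (U `&` W, [set d : R | d < r / 2]).
    split => /=; last exact: nbhs_right_lt.
    apply: filterI => //.
    apply: (filter_forall (F := nbhs p)) => i.
    have /cvgrPdist_lt/(_ _ r2) := C_k_cont (C_k_coord R 0 i) p0.
    by apply: filterS => q; rewrite distrC.
  move=> [q d] [/= [[Cq Fq] qp] dr] _ _ w w0 qw.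
  have [i|Cw Fw] := rU w w0.
    have := ler_distD (cone_coord i q) (cone_coord i w) (cone_coord i p).
    have := qw i; have := qp i.
    by rewrite (distrC (cone_coord i q) (cone_coord i w)); lra.
  split => //; have := ler_distD (F p) (F w) (F q).
  by rewrite (distrC (F w) (F p)); lra.
move=> near_d.
have : \forall d \near 0^'+, 0 < d /\ ((`[t0, 1]%classic `*` closure X) `<=` P d).
  by apply: filterI => //; exact: nbhs_right_gt.
move=> /filter_ex[d [d0 dP]].
exists d => // p q [cylp [tp Sp]]; apply: dP => //; split => /=.
  by rewrite in_itv /= tp ltW//; case: cylp => /andP[].
by apply: subset_closure; case: cylp.
Qed.

End compactness.

(** * The maximum principle *)
Section touching.
Context (R : realType) (m : nat).
Local Notation pt := (R * 'rV[R]_m)%type.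
Implicit Types (X : set 'rV[R]_m) (x y : 'rV[R]_m) (p q : pt).

Definition row_dist (x y : 'rV[R]_m) : R := Num.sqrt (row_sq_dist x y).

Definition parabola (A r : R) : R := (2 * A - r) * r.

Lemma parabola_ge0 A r : 0 <= r <= A -> 0 <= parabola A r.
Proof. by move=> /andP[r0 rA]; rewrite mulr_ge0//; lra. Qed.

Lemma parabola_lt A r s : 0 <= r -> r < s -> s <= A -> parabola A r < parabola A s.
Proof.
move=> r0 rs sA; rewrite -subr_gt0 /parabola.
rewrite [ltRHS](_ : _ = (s - r) * (2 * A - s - r)); last by ring.
by rewrite mulr_gt0; lra.
Qed.

Lemma parabola_le A r : parabola A r <= A ^+ 2.
Proof.
rewrite -subr_ge0 /parabola [leRHS](_ : _ = (A - r) ^+ 2) ?sqr_ge0//; by ring.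
Qed.

Lemma row_dist_ge0 x y : 0 <= row_dist x y.
Proof. exact: sqrtr_ge0. Qed.

Lemma row_dist_lt x y (A : R) : 0 < A -> (row_dist x y < A) = (row_sq_dist x y < A ^+ 2).
Proof.
move=> A0; rewrite -(sqr_sqrtr (row_sq_dist_ge0 x y)).
by rewrite ltr_pXn2r ?nnegrE ?sqrtr_ge0 ?(ltW A0).
Qed.

Lemma row_dist_le x y (A : R) : 0 < A -> (row_dist x y <= A) = (row_sq_dist x y <= A ^+ 2).
Proof.
move=> A0; rewrite -(sqr_sqrtr (row_sq_dist_ge0 x y)).
by rewrite ler_pXn2r ?nnegrE ?sqrtr_ge0 ?(ltW A0).
Qed.

(** A horizontal covector: as it has no [ln t] component, a function of the corresponding affine
    coordinate gets no drift term. *)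
Definition normal_coef (u : 'rV[R]_m) (i : 'I_m.+1) : R :=
  if unlift ord0 i is Some j then u 0 j else 0.

Lemma affine_coord_normal (u y : 'rV[R]_m) p :
  affine_coord (normal_coef u) (- row_dot u y) p = row_dot u (p.2 - y).
Proof.
rewrite /affine_coord big_ord_recl /normal_coef unlift_none mul0r add0r.
rewrite /row_dot -sumrN -big_split /=; apply: eq_bigr => j _.
by rewrite liftK /cone_coord liftK !mxE mulrBr.
Qed.

(* At a maximum point the distance to the complement is realised by the second
   component, so projecting on the tangent hyperplane stays outside [X] and
   turns the distance into an affine function. *)
Lemma outer_max_touch X (w : pt -> R) (A c t0 : R) p0 y0 :
  convex_set X -> open X -> 0 < A -> 0 < c -> 0 < t0 ->
  cylinder X p0 -> t0 < p0.1 ->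
  (exists2 y, ~ X y & row_sq_dist p0.2 y < A ^+ 2) ->
  outer_pairs X t0 A (p0, y0) ->
  (forall p y, outer_pairs X t0 A (p, y) ->
     w p - c * parabola A (row_dist p.2 y) <=
     w p0 - c * parabola A (row_dist p0.2 y0)) ->
  exists u k, row_dot u u = 1 /\
    local_max_in (cylinder X)
     (w \- (fun p => c * ((2 * A - affine_coord (normal_coef u) k p) *
                            affine_coord (normal_coef u) k p))) p0.
Proof.
move=> cX oX A0 c0 t00 cylp0 tp0 [y' nXy' y'A] [/= tp1 Xp0 nXy0 y0A] maxU.
have p00 : 0 < p0.1 by case: cylp0 => /andP[].
have XX0 : X p0.2 by case: cylp0.
set x0 := p0.2 in XX0 *; pose r0 := row_dist x0 y0.
have r0A' : r0 <= A by rewrite row_dist_le.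
have near y : ~ X y -> row_dist x0 y < A -> r0 <= row_dist x0 y.
  move=> nXy yA; rewrite leNgt; apply/negP => lt.
  have : outer_pairs X t0 A (p0, y) by split => //=; rewrite -row_dist_le// ltW.
  move=> /maxU; rewrite lerD2l lerN2 ler_pM2l// leNgt => /negP; apply.
  by apply: parabola_lt => //; exact: row_dist_ge0.
(* Strictness leaves room: points of the complement beyond [A] are farther than [y0], and the affine
   coordinate stays below [A] near [p0]. *)
have r0A : r0 < A.
  by apply: le_lt_trans (near y' nXy' _) _; rewrite row_dist_lt.
have nearest y : ~ X y -> row_sq_dist x0 y0 <= row_sq_dist x0 y.
  move=> nXy; rewrite -(sqr_sqrtr (row_sq_dist_ge0 x0 y0)).
  rewrite -(sqr_sqrtr (row_sq_dist_ge0 x0 y)) lerXn2r ?nnegrE ?sqrtr_ge0//.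
  have [yA|Ay] := ltP (row_dist x0 y) A; first exact: near.
  exact: le_trans Ay.
have sq0 : 0 < row_sq_dist x0 y0.
  by apply: row_sq_dist_gt0; apply/eqP => xy; apply: nXy0; rewrite -xy.
have r00 : 0 < r0 by rewrite sqrtr_gt0.
have r0sq : r0 ^+ 2 = row_sq_dist x0 y0 by rewrite sqr_sqrtr// ltW.
pose u : 'rV[R]_m := r0^-1 *: (x0 - y0).
have uu : row_dot u u = 1.
  rewrite /u row_dotZl row_dotC row_dotZl -row_sq_distE -r0sq.
  by field; rewrite gt_eqF.
have lE p : affine_coord (normal_coef u) (- row_dot u y0) p = row_dot u (p.2 - y0).
  exact: affine_coord_normal.
have l0 : affine_coord (normal_coef u) (- row_dot u y0) p0 = r0.
  rewrite lE /u row_dotZl -row_sq_distE -r0sq expr2 mulKf// gt_eqF//.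
exists u, (- row_dot u y0); split=> //; split=> //.
have cl := C_k_cont (C_k_affine_coord 0 (normal_coef u) (- row_dot u y0)) p00.
(* These bounds put the pair of [p] and its projection [y] in [outer_pairs]. *)
have : \forall p \near p0, 0 < affine_coord (normal_coef u) (- row_dot u y0) p /\
    affine_coord (normal_coef u) (- row_dot u y0) p < A /\ t0 < p.1.
  apply: filterI; first by apply: (cvgr_gt _ cl); rewrite l0.
  apply: filterI; first by apply: (cvgr_lt _ cl); rewrite l0.
  by apply: (cvgr_gt _ (@cvg_fst _ _ (nbhs p0.1) (nbhs p0.2) _)).
apply: filterS => p; rewrite lE => -[lp0 [lpA tp]] cylp /=.
rewrite !lE -/x0 -[row_dot u (x0 - y0)]lE l0.
set l := row_dot u (p.2 - y0) in lp0 lpA *.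
pose y := p.2 - l *: u.
have ly : row_dist p.2 y = l.
  rewrite /row_dist row_sq_distE.
  have -> : p.2 - y = l *: u by rewrite /y opprB addrC subrK.
  rewrite row_dotZl row_dotC row_dotZl uu mulr1 -expr2 sqrtr_sqr gtr0_norm//.
have nXy : ~ X y.
  move=> Xy; have := convex_nearest cX oX XX0 nXy0 nearest Xy.
  have -> : x0 - y0 = r0 *: u by rewrite /u scalerA mulfV ?scale1r// gt_eqF.
  rewrite row_dotZl row_dotC /y addrAC row_dotBl row_dotZl uu mulr1 (row_dotC _ u).
  by rewrite -/l subrr mulr0 ltxx.
have := maxU p y; rewrite ly => U.
have {}U := U _; apply: le_trans (U _) _.
- split => //=; last by rewrite -row_dist_le// ly ltW.
    by rewrite (ltW tp) ltW//; case: cylp => /andP[].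
  by apply: subset_closure; case: cylp.
by rewrite /parabola.
Qed.

Lemma continuous_row_dist (V : topologicalType) (u v : V -> 'rV[R]_m) :
  continuous u -> continuous v -> continuous (fun a : V => row_dist (u a) (v a)).
Proof.
move=> cu cv a; apply: (@continuous_comp _ _ _ (fun a => row_sq_dist (u a) (v a)) Num.sqrt).
  exact: continuous_row_sq_dist.
exact: sqrt_continuous.
Qed.

Lemma within_outer_pairs X (w v : pt -> R) (t0 A c : R) : open X -> 0 < t0 ->
  {within cylinder_closure X, continuous v} -> continuous_in (@half_space R m) w ->
  {within outer_pairs X t0 A, continuous (fun z =>
     v z.1 - w z.1 - c * parabola A (row_dist z.1.2 z.2))}.
Proof.
move=> oX t00 cv cw; apply/subspace_continuousP => -[p y] /= [/= tp Xp nXy yA].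
have p0 : 0 < p.1 by case/andP: tp => tp _; exact: lt_le_trans tp.
have Cp := cylinder_closureP oX t00 tp Xp.
apply: cvgB; first apply: cvgB.
- have := (subspace_continuousP _ _).1 cv p Cp; apply: cvg_trans.
  move=> B /= vB.
  have : nbhs (p, y) [set z : pt * 'rV[R]_m | cylinder_closure X z.1 -> B (v z.1)].
    by exists ([set q | cylinder_closure X q -> B (v q)], setT);
      [split; [exact: vB|exact: filterT]|move=> [q z] /= [+ _]; exact].
  apply: filterS => -[q z] /= qB [/= tq Xq _ _]; apply: qB.
  exact: cylinder_closureP oX t00 tq Xq.
- apply: cvg_within_filter.
  apply: (@continuous_comp _ _ _ (fun z : pt * 'rV[R]_m => z.1) w); first exact: cvg_fst.
  exact: cw.
apply: cvg_within_filter.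
have cr : continuous (fun z : pt * 'rV[R]_m => row_dist z.1.2 z.2).
  apply: continuous_row_dist => z; last exact: cvg_snd.
  by apply: continuous_comp; [exact: cvg_fst|exact: cvg_snd].
apply: cvgM; first exact: cvg_cst.
by apply: cvgM; [apply: cvgB; [exact: cvg_cst|exact: cr]|exact: cr].
Qed.

End touching.

(** * The bound from above for subsolutions *)

Section bound.
Context (R : realType) (m : nat).
Local Notation pt := (R * 'rV[R]_m.+1)%type.
Implicit Types (X : set 'rV[R]_m.+1) (p q o : pt).

Lemma cone_coord_sq_dist o p i (rho : R) : 0 < rho ->
  sq_dist (fun j => cone_coord j o) p < rho ^+ 2 ->
  `|cone_coord i p - cone_coord i o| < rho.
Proof.
move=> r0 lt; rewrite -(ltr_pXn2r (n := 2))// ?nnegrE ?(ltW r0)//.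
rewrite real_normK ?num_real//; apply: le_lt_trans lt.
rewrite /sq_dist (bigD1 i)//= lerDl; apply: sumr_ge0 => j _; exact: sqr_ge0.
Qed.

Lemma test_function_operator (phi : pt -> R) d1 d2 o p (c k A : R) u l :
  second_order phi d1 d2 -> 0 < p.1 -> row_dot u u = 1 ->
  let psi q := phi q + k * sq_dist (fun j => cone_coord j o) q +
    c * ((2 * A - affine_coord (normal_coef u) l q) *
                            affine_coord (normal_coef u) l q) in
  C_k 2 (@half_space R m.+1) psi /\
  p.1 ^+ 2 * cone_operator psi p = p.1 ^+ 2 * cone_operator phi p +
    k * (2 * m.+2%:R + m%:R * (2 * (cone_coord ord0 p - cone_coord ord0 o))) - 2 * c.
Proof.
move=> sphi p0 uu psi.
have spsi := second_orderD (second_orderD sphi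
  (second_orderZ k (second_order_sq_dist (fun j => cone_coord j o))))
  (second_orderZ c (second_order_parabola A (normal_coef u) l)).
split; first by case: spsi.
rewrite (second_order_operator spsi p0) (second_order_operator sphi p0).
have -> : m.+2%:R - 2 = m%:R :> R by rewrite -addn2 natrD addrK.
rewrite !big_split /= sumr_const card_ord -mulr_sumr -mulr_sumr.
have -> : \sum_i normal_coef u i ^+ 2 = 1.
  rewrite big_ord_recl /normal_coef unlift_none expr0n /= add0r -uu.
  by apply: eq_bigr => j _; rewrite liftK expr2.
rewrite -[_ *+ m.+2]mulr_natr /normal_coef unlift_none; ring.
Qed.

(** A positive upper bound [N] stands for the norm, since the potential is built with an error
    proportional to [N]. The constant precedes the domain and the data, so it depends only on [m]
    and [d0]. *)
Lemma subsolution_bound (d0 : R) : (0 < m)%N -> 0 < d0 ->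
  exists2 C : R, 0 < C &
  forall X (h : R -> R) (f v : pt -> R) (S N B : R),
    bounded_set X -> convex_set X -> open X ->
    (forall x, X x -> exists2 y, ~ X y & row_sq_dist x y < (2 * d0) ^+ 2) ->
    (forall r, 0 <= r -> h r <= 0) ->
    continuous_in (cylinder X) f ->
    {within cylinder_closure X, continuous v} ->
    viscosity_subsolution h f (cylinder X) v ->
    0 <= S -> (forall p, cylinder_boundary X p -> v p <= S) ->
    (forall p, cylinder X p -> v p <= B) ->
    0 < N ->
    (cone_integral (cylinder X) (fun p => (`|(p.1 ^+ 2 * f p)%R| ^+ m.+2)%:E)
      <= (N ^+ m.+2)%:E)%E ->
  forall p, cylinder X p -> v p <= S + C * N.
Proof.
move=> m0 d00; pose A : R := 2 * d0; have A0 : 0 < A by rewrite mulr_gt0.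
(* With [k = M / rho ^ 2] the coefficient [c] below is at most [K M / rho], so [rho >= 4 K A ^ 2]
   gives [c A ^ 2 <= M / 4]. As [rho] involves only [m] and [d0], so does [C1]. *)
pose K : R := m.+2%:R + m%:R + 1.
have K0 : 0 < K by rewrite ltr_wpDl.
pose rho : R := 4 * K * A ^+ 2 + 1.
have rho1 : 1 <= rho by rewrite lerDr mulr_ge0 ?exprn_ge0 ?(ltW A0)// mulr_ge0// ltW.
have rho0 : 0 < rho by exact: lt_le_trans rho1.
have [C1 C10 pot] := @cone_potential_ex R m rho m0 rho0.
exists (4 * C1); first by rewrite mulr_gt0.
move=> X h f v S N B bX cX oX near hle0 cf cv [uscv visc] S0 vS vB N0 FN p1 cylp1.
rewrite leNgt; apply/negP => big.
pose E := [set v p - S | p in cylinder X].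
have E0 : E !=set0 by exists (v p1 - S); exists p1.
have supE : has_sup E.
  by split => //; exists (B - S) => _ [p cylp <-]; rewrite lerD2r vB.
pose M := sup E.
have vM p : cylinder X p -> v p - S <= M.
  by move=> cylp; apply: sup_upper_bound => //; exists p.
have MN : 4 * C1 * N < M by apply: lt_le_trans (vM p1 cylp1); rewrite ltrBrDl.
have M0 : 0 < M by apply: lt_trans MN; rewrite !mulr_gt0.
have M4 : 0 < M / 4 by rewrite divr_gt0.
have [_ [ o cylo <-] oM] := sup_adherent M4 supE; rewrite -/M in oM.
have o0 : 0 < o.1 by case: cylo => /andP[].
(* [ln t0] is [rho] below [ln o.1], so points nearer than [rho] to [o] lie strictly above the level
   [t0]. *)
pose t0 := o.1 * expR (- rho).
have t00 : 0 < t0 by rewrite mulr_gt0 ?expR_gt0.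
have t0o : t0 < o.1 by rewrite gtr_pMr// expR_lt1 oppr_lt0.
pose F p := p.1 ^+ 2 * f p.
have cF : continuous_in (cylinder X) F.
  move=> p cylp; apply: cvgM; last exact: cf.
  by apply: cvgM; exact: cvg_fst.
have vS' p : cylinder_boundary X p -> v p < S + M / 4.
  by move=> /vS /le_lt_trans; apply; rewrite ltrDl.
have unif := uniform_inside bX oX t00 cv cF vS'.
pose upper : set pt := [set p | cylinder X p /\ t0 <= p.1 /\ S + M / 4 <= v p].
have [phi [d1 [d2 [sphi phi0 Lphi0 LphiF phio]]]] :
    exists phi d1 d2, [/\ second_order phi d1 d2,
    forall p, 0 < p.1 -> 0 <= phi p,
    forall p, 0 < p.1 -> p.1 ^+ 2 * cone_operator phi p <= 0,
    forall p, upper p -> (forall i, `|cone_coord i p - cone_coord i o| < rho) ->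
       p.1 ^+ 2 * cone_operator phi p <= - `|F p| &
    phi o <= C1 * N].
  apply: (pot (cylinder X) upper F o N) => //.
  - by move=> p [/andP[]].
  - by move=> p [[/andP[]]].
(* The quadratic penalty reaches [M] at distance [rho], which confines the maximum point to the cone
   ball of radius [rho] around [o]. *)
pose k := M / rho ^+ 2.
have k0 : 0 < k by rewrite divr_gt0// exprn_gt0.
pose w p := phi p + k * sq_dist (fun j => cone_coord j o) p.
(* In that ball the penalty adds at most [k (2 m.+2 + 2 m rho)] to the operator, and [2 c] exceeds
   this by [2 k]. *)
pose c := k * (m.+2%:R + m%:R * rho + 1).
have c0 : 0 < c.
  by rewrite mulr_gt0// ltr_wpDl// addr_ge0// mulr_ge0// ltW.
have cA : c * A ^+ 2 <= M / 4.
  have cK : m.+2%:R + m%:R * rho + 1 <= K * rho.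
    have : 0 <= m%:R :> R by [].
    have : 0 <= m.+2%:R :> R by [].
    rewrite /K; move: rho1; clear; nra.
  have : c * A ^+ 2 <= k * (K * rho) * A ^+ 2.
    by apply: ler_wpM2r; [rewrite exprn_ge0// ltW|rewrite ler_pM2l].
  move=> /le_trans; apply.
  have -> : k * (K * rho) * A ^+ 2 = (M / 4) * ((4 * K * A ^+ 2) / rho).
    by rewrite /k; field; rewrite gt_eqF.
  rewrite ler_piMr ?(ltW M4)// ler_pdivrMr// mul1r /rho lerDl//.
pose U (z : pt * 'rV[R]_m.+1) := v z.1 - w z.1 - c * parabola A (row_dist z.1.2 z.2).
have [Cphi _ _] := sphi.
have cw : continuous_in (@half_space R m.+1) w.
  have [Csq _ _] := second_order_sq_dist (fun j => cone_coord j o).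
  exact: (C_k_cont (C_kD (@open_half_space R m.+1) Cphi
     (C_kZ k (@open_half_space R m.+1) Csq))).
have cU := within_outer_pairs (A := A) (c := c) oX t00 cv cw.
have cQ := compact_outer_pairs (t0 := t0) bX oX (ltW A0).
have [yo nXyo yoA] := near o.2 cylo.2.
have Qo : outer_pairs X t0 A (o, yo).
  split => //=; last exact: ltW.
    by rewrite (ltW t0o) ltW//; case: cylo => /andP[].
  by apply: subset_closure; case: cylo.
have [[p0 y0] Qz maxU] := compact_EVT_max (ex_intro _ _ Qo) cQ cU.
rewrite inE in Qz.
have {}maxU p y : outer_pairs X t0 A (p, y) -> U (p, y) <= U (p0, y0).
  by move=> Qp; apply: maxU; rewrite inE.
(* Of the excess [v o - S > 3 M / 4], the potential takes at most [C1 N < M / 4] and the parabola at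
   most [M / 4]. *)
have Uo : S + M / 4 < U (o, yo).
  rewrite /U /w /= [sq_dist _ o]big1 ?mulr0 ?addr0 => [|i _]; last first.
    by rewrite subrr expr0n.
  have : c * parabola A (row_dist o.2 yo) <= M / 4.
    by apply: le_trans cA; rewrite ler_pM2l// parabola_le.
  move: oM phio MN; clear; lra.
have U0 : S + M / 4 < U (p0, y0) by apply: lt_le_trans Uo (maxU _ _ Qo).
have [/= tp Xp nXy yA] := Qz.
have p00 : 0 < p0.1 by case/andP: tp => tp _; exact: lt_le_trans tp.
have par0 : 0 <= c * parabola A (row_dist p0.2 y0).
  apply: mulr_ge0; first exact: ltW.
  by apply: parabola_ge0; rewrite row_dist_ge0 row_dist_le.
have sq0 := sq_dist_ge0 (fun j => cone_coord j o) p0.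
have ksq0 : 0 <= k * sq_dist (fun j => cone_coord j o) p0 by rewrite mulr_ge0// ltW.
have vp0 : S + M / 4 < v p0.
  move: U0 (phi0 p0 p00); rewrite /U /w /=; move: par0 ksq0; clear; lra.
have cylp0 : cylinder X p0.
  have [//|/vS'] := cylinder_closureP oX t00 tp Xp.
  by move=> /(lt_trans vp0); rewrite ltxx.
have dist0 : sq_dist (fun j => cone_coord j o) p0 < rho ^+ 2.
  have : k * sq_dist (fun j => cone_coord j o) p0 < M.
    move: U0 (phi0 p0 p00) (vM p0 cylp0); rewrite /U /w /=; move: par0 M0; clear; lra.
  by rewrite /k mulrAC ltr_pdivrMr ?exprn_gt0// ltr_pM2l.
have coord0 i := cone_coord_sq_dist i rho0 dist0.
have tp0 : t0 < p0.1.
  have := coord0 ord0; rewrite /cone_coord unlift_none ltr_norml => /andP[ol _].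
  by rewrite ltrBrDl -ltr_expR expRD !lnK in ol.
have upp0 : upper p0 by split => //; split; exact: ltW.
have LF := LphiF p0 upp0 coord0.
have [u [l [uu [_ lmax]]]] := outer_max_touch (w := v \- w) cX oX A0 c0 t00
  cylp0 tp0 (near p0.2 cylp0.2) Qz (fun p y => maxU p y).
pose psi q := w q + c * ((2 * A - affine_coord (normal_coef u) l q) *
                         affine_coord (normal_coef u) l q).
have [Cpsi Lpsi] : C_k 2 (@half_space R m.+1) psi /\ _ :=
  test_function_operator o c k A l sphi p00 uu.
have cyl_half : cylinder X `<=` @half_space R m.+1 by move=> p [/andP[]].
have lm : local_max_in (cylinder X) (v \- psi) p0.
  split => //; apply: filterS lmax => q lq cylq; have := lq cylq.
  by rewrite /= /psi !opprD !addrA.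
(* As [h (v p0) <= 0], [F p0] is at most [p0.1 ^ 2] times the operator on [psi], which by the choice
   of [c] is less than [- |F p0|]: a contradiction. *)
have fle := visc psi (C_k_sub cyl_half Cpsi) p0 lm.
have hv : h (v p0) <= 0 by apply: hle0; move: vp0 S0 M4; clear; lra.
have FL : F p0 <= p0.1 ^+ 2 * cone_operator psi p0.
  by rewrite /F ler_pM2l ?exprn_gt0//; move: fle hv; clear; lra.
rewrite Lpsi /c in FL.
have := coord0 ord0; rewrite ltr_norml => /andP[_ c1].
have : k * (m%:R * (cone_coord ord0 p0 - cone_coord ord0 o)) <= k * (m%:R * rho).
  by rewrite ler_pM2l// ler_wpM2l// ltW.
have := ler_norm (- F p0); rewrite normrN.
by move: FL LF k0; rewrite !mulrDr; clear; lra.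
Qed.

End bound.

(** * The change of sign from [v] to [- v] *)

Section reflection.
Context (R : realType) (m : nat).
Local Notation pt := (R * 'rV[R]_m)%type.
Implicit Types (D : set pt) (u v phi : pt -> R) (p q : pt).

Lemma C_k_cone_field k D i u : open D -> C_k k.+1 D u -> C_k k D (cone_field i u).
Proof.
move=> oD [_ du]; have [_ Cu] := du (cone_dir R i).
have Cw : C_k k D (cone_weight i).
  rewrite /cone_weight; case: eqP => _; last exact: C_k_cst.
  have c1 : continuous_in D (@fst R 'rV[R]_m) by move=> p _; exact: cvg_fst.
  exact: (C_k_affine k oD c1 (@fst_shift R m)).
by apply: C_k_eq (C_kM oD Cw Cu) => // p _; rewrite cone_fieldE.
Qed.

Lemma cone_fieldN D i u p : D p -> C_k 1 D u ->
  cone_field i (fun q => - u q) p = - cone_field i u p.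
Proof.
by move=> Dp [_ du]; rewrite !cone_fieldE deriveN ?mulrN//; exact: (du _).1.
Qed.

Lemma cone_hessianE u p i j : cone_hessian u p i j = cone_field i (cone_field j u) p.
Proof. by rewrite mxE. Qed.

Lemma cone_operatorN D phi p : open D -> D p -> C_k 2 D phi ->
  cone_operator (fun q => - phi q) p = - cone_operator phi p.
Proof.
move=> oD Dp C2; have C1 := C_kS C2.
have lapN : cone_laplacian (fun q => - phi q) p = - cone_laplacian phi p.
  have hessN i j : cone_hessian (fun q => - phi q) p i j = - cone_hessian phi p i j.
    apply: (etrans (cone_hessianE _ _ _ _)); rewrite (cone_hessianE phi).
    transitivity (cone_field i (fun q => - cone_field j phi q) p).
      rewrite !cone_fieldE; congr (_ * _); apply: near_eq_derive.
      by apply: (open_near_eq oD Dp) => q Dq; rewrite (cone_fieldN _ Dq C1).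
    exact: cone_fieldN Dp (C_k_cone_field j oD C2).
  transitivity (\sum_i - cone_hessian phi p i i); last exact: sumrN.
  by apply: eq_bigr => i _; exact: hessN.
rewrite /cone_operator lapN (cone_fieldN _ Dp C1).
by rewrite 2!mulrN -opprD.
Qed.

(** The reflected nonlinearity [- h (- r)] is non-increasing whenever [h] is, so a bound from above
    for [- v] can be had in the same way and gives the bound from below for [v]. *)
Lemma viscosity_supersolutionN h f D v : open D ->
  viscosity_supersolution h f D v ->
  viscosity_subsolution (fun r => - h (- r)) (fun p => - f p) D (fun p => - v p).
Proof.
move=> oD [lscv visc]; split=> [p Dp a|phi Cphi p [Dp lmax]].
  rewrite ltrNl => /(lscv p Dp); apply: filterS => q va /va.
  by rewrite ltrNl.
have Cn : C_k 2 D (fun q => - phi q).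
  by apply: C_k_eq (C_kZ (-1) oD Cphi) => // q _; rewrite mulN1r.
have lmin : local_min_in D (v \- (fun q => - phi q)) p.
  split => //; apply: filterS lmax => q lq Dq; have := lq Dq => /=; lra.
by have := visc _ Cn p lmin; rewrite (cone_operatorN oD Dp Cphi) opprK; lra.
Qed.

End reflection.

Lemma cone_Lnorm_integral (R : realType) (m n : nat) (D : set (R * 'rV[R]_m))
    (g : R * 'rV[R]_m -> R) (N : R) : (0 < n)%N -> 0 <= N ->
  (forall p, D p -> 0 < p.1) ->
  (cone_Lnorm n D g <= N%:E)%E ->
  (cone_integral D (fun p => (`|g p| ^+ n)%:E) <= (N ^+ n)%:E)%E.
Proof.
move=> n0 N0 D0; rewrite /cone_Lnorm; set I := cone_integral _ _.
have I0 : (0 <= I)%E.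
  apply: integral_ge0 => z Dz; rewrite -EFinM lee_fin mulr_ge0 ?exprn_ge0//.
  by rewrite invr_ge0 ltW// D0.
case: I I0 => [i||]//; rewrite ?lee_fin => i0.
  move=> iN.
  have -> : i = (i `^ n%:R^-1) ^+ n.
    by rewrite -powR_mulrn ?powR_ge0// -powRrM mulVf ?powRr1// pnatr_eq0 -lt0n.
  by rewrite lerXn2r ?nnegrE ?powR_ge0.
(* An infinite integral has an infinite root, which the bound by [N] excludes. *)
by rewrite poweRyr ?invr_eq0 ?pnatr_eq0 -?lt0n// leye_eq.
Qed.

Theorem corollary1p1 (R : realType) (n : nat) (K0 sigma d0 : R) :
  (3 <= n)%N -> 1 <= K0 -> 0 < sigma < 1 -> 0 < d0 ->
  exists2 Cstar : R, 0 < Cstar &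
  forall (X : set 'rV[R]_n.-1) (h : R -> R) (f v : R * 'rV[R]_n.-1 -> R),
    bounded_set X -> convex_set X -> open X -> smooth_boundary X ->
    condition_G X K0 sigma d0 ->
    continuous h -> (forall a b, a <= b -> h b <= h a) -> h 0 = 0 ->
    continuous_in (cylinder X) f ->
    {within cylinder_closure X, continuous v} ->
    viscosity_solution h f (cylinder X) v ->
    (ereal_sup [set `|v p|%:E | p in cylinder X] < +oo)%E ->
    (exists2 g : R * 'rV[R]_n.-1 -> R,
       {within cylinder_closure X, continuous g} &
       forall p, cylinder X p -> g p = p.1 ^+ 2 * f p) ->
    (cone_Lnorm n (cylinder X) (fun p => p.1 ^+ 2 * f p)%R < +oo)%E ->
    (ereal_sup [set `|v p|%:E | p in cylinder X] <=
     ereal_sup [set `|v p|%:E | p in cylinder_boundary X] +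
     (Cstar * K0 * d0)%:E *
       cone_Lnorm n (cylinder X) (fun p => p.1 ^+ 2 * f p)%R)%E.
Proof.
case: n => [|[|[|m]]]// _ K1 _ d00.
have K0p : 0 < K0 by exact: lt_le_trans K1.
have [C C0 bound] := @subsolution_bound R m.+1 d0 isT d00.
(* [C] already depends on [d0]; the division cancels the factor [K0 d0] of the statement. *)
exists (C / (K0 * d0)); first by rewrite divr_gt0// mulr_gt0.
have -> : C / (K0 * d0) * K0 * d0 = C by field; rewrite !gt_eqF.
move=> X h f v bX cX oX _ GX _ hmono h0 cf cv [sub sup] vfin _.
set L := cone_Lnorm _ _ _; set Sb := ereal_sup [set _ | _ in cylinder_boundary X].
move=> Lfin.
have L0 : (0 <= L)%E by exact: poweR_ge0.
have [l lE] : exists l, L = l%:E by case: L L0 Lfin => [l||]// _ _; exists l.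
have l0 : 0 <= l by rewrite -lee_fin -lE.
apply: ge_ereal_sup => _ [p cylp <-].
have vSb q : cylinder_boundary X q -> (`|v q|%:E <= Sb)%E.
  by move=> bq; apply: ereal_sup_ubound; exists q.
(* The boundary contains the point over [p.2] at [t = 1], so this is not the supremum of the empty
   set. *)
have Sb0 : (0 <= Sb)%E.
  apply: le_trans (vSb (1, p.2) _); first by rewrite lee_fin.
  by left; case: cylp.
case: Sb Sb0 vSb => [S||]//; last by move=> _ _; rewrite lE -EFinM addye// leey.
rewrite lee_fin => S0 vS.
have near x := condition_G_dist d00 oX GX (x := x).
pose B := fine (ereal_sup [set `|v q|%:E | q in cylinder X]).
have vB q : cylinder X q -> `|v q| <= B.
  move=> cylq; have vq : (`|v q|%:E <= ereal_sup [set `|v q|%:E | q in cylinder X])%E.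
    by apply: ereal_sup_ubound; exists q.
  rewrite -lee_fin /B fineK// fin_real//= vfin andbT.
  by apply: lt_le_trans vq; rewrite ltNyr.
rewrite lE -EFinM -EFinD lee_fin; apply/ler_addgt0Pr => e e0.
(* The slack [e] allows [N = l + e / C], which is positive even if the norm [l] is 0. *)
have eC0 : 0 < e / C by rewrite divr_gt0.
have N0 : 0 < l + e / C by rewrite ltr_wpDl.
have -> : S + C * l + e = S + C * (l + e / C) by field; rewrite gt_eqF.
have int (g : R * 'rV[R]_m.+2 -> R) : (forall q, `|g q| = `|f q|) ->
    (cone_integral (cylinder X) (fun p => (`|(p.1 ^+ 2 * g p)%R| ^+ m.+3)%:E)
      <= ((l + e / C) ^+ m.+3)%:E)%E.
  move=> gf; rewrite (_ : (fun p => _) = fun p => (`|p.1 ^+ 2 * f p| ^+ m.+3)%:E).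
    apply: cone_Lnorm_integral => //; first exact: ltW.
      by move=> q [/andP[]].
    by rewrite -/L lE lee_fin lerDl ltW.
  by apply/funext => q; rewrite !normrM gf.
have hle r : 0 <= r -> h r <= 0 by move=> r0; rewrite -h0 hmono.
have hge r : 0 <= r -> - h (- r) <= 0.
  by move=> r0; rewrite oppr_le0 -h0 hmono// oppr_le0.
(* The lower bound is the upper bound for [- v], a subsolution for the reflected data. *)
rewrite ler_norml lerNl; apply/andP; split.
- apply: (bound X (fun r => - h (- r)) (fun q => - f q) (fun q => - v q) S _ B) => //.
  + by move=> q cylq; apply: cvgN; exact: cf.
  + by move=> q; apply: continuousN => ?; exact: cv.
  + by apply: viscosity_supersolutionN => //; exact: open_cylinder.
  + move=> q /vS; rewrite lee_fin; apply: le_trans; rewrite -normrN; exact: ler_norm.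
  + move=> q /vB; apply: le_trans; rewrite -normrN; exact: ler_norm.
  + by apply: int => q; rewrite normrN.
- apply: (bound X h f v S _ B) => //.
  + by move=> q /vS; rewrite lee_fin; apply: le_trans; exact: ler_norm.
  + by move=> q /vB; apply: le_trans; exact: ler_norm.
  + exact: int.
Qed.
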